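(* A flag triangulation of the real projective plane $\mathbb{R}P^2$ with the minimum number of vertices (among all flag triangulations of $\mathbb{R}P^2$) has exactly 11 vertices.
   Context: A simplicial complex is flag if all its minimal non-faces have cardinality 2. *)

(* Defs.v *)
From HB Require Import structures.
From mathcomp Require Import all_boot all_order all_algebra.
From mathcomp Require Import generic_quotient.
From mathcomp Require Import boolp classical_sets functions reals topology.
From mathcomp Require Import normedtype.

Set Implicit Arguments.
Unset Strict Implicit.
Unset Printing Implicit Defensive.

Import Order.TTheory GRing.Theory Num.Theory.
Import numFieldNormedType.Exports.

Local Open Scope classical_set_scope.
Local Open Scope ring_scope.
Local Open Scope quotient_scope.

Definition homeomorphic (X Y : topologicalType) : Prop :=
  exists (f : X -> Y) (g : Y -> X),
    [/\ continuous f, continuous g, cancel f g & cancel g f].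

Section Complex.
Variable T : finType.
Implicit Type K : {set {set T}}.

(* Abstract simplicial complex whose vertex set is all of T, so that its number
   of vertices is #|T|. The empty face belongs to every complex. *)
Definition simplicial_complex K : Prop :=
  [/\ finset.set0 \in K,
      forall v : T, [set v]%SET \in K
    & forall s t : {set T}, s \in K -> t \subset s -> t \in K].

Definition minimal_nonface K (s : {set T}) : bool :=
  minset (fun t : {set T} => t \notin K) s.

Definition flag K : Prop :=
  forall s : {set T}, minimal_nonface K s -> #|s| = 2%N.

(* Barycentric coordinates: points of R^T, with the product topology. *)
Definition realization_set (R : realType) K : set {ptws T -> R} :=
  [set x : {ptws T -> R} |
    [/\ forall v, 0 <= x v,
        \sum_v x v = 1
      & [set v | x v != 0]%SET \in K]].

End Complex.

Arguments realization_set {T} R K.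

Definition realization (R : realType) (T : finType) (K : {set {set T}})
    : topologicalType :=
  set_type (realization_set R K).

Definition sphere2 (R : realType) : set 'rV[R]_3 :=
  [set x : 'rV[R]_3 | \sum_(i < 3) x ord0 i ^+ 2 = 1].

Arguments sphere2 R : clear implicits.

Section ProjectivePlane.
Variable R : realType.

Definition antipodal (x y : set_type (sphere2 R)) : bool :=
  (\val x == \val y) || (\val x == - \val y).

Lemma antipodal_refl : reflexive antipodal.
Proof. by move=> x; rewrite /antipodal eqxx. Qed.

Lemma antipodal_sym : symmetric antipodal.
Proof. by move=> x y; rewrite /antipodal eq_sym -eqr_oppLR (eq_sym (- _)). Qed.

Lemma antipodal_trans : transitive antipodal.
Proof.
move=> y x z; rewrite /antipodal => /orP[] /eqP -> // /orP[] /eqP ->.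
  by rewrite eqxx orbT.
by rewrite opprK eqxx.
Qed.

Definition antipodal_equiv : equiv_rel (set_type (sphere2 R)) :=
  EquivRel antipodal antipodal_refl antipodal_sym antipodal_trans.

Definition RP2 : topologicalType :=
  quotient_topology {eq_quot antipodal_equiv}.

End ProjectivePlane.

Definition RP2_triangulation (R : realType) (T : finType) (K : {set {set T}})
    : Prop :=
  simplicial_complex K /\ homeomorphic (realization R K) (RP2 R).

(* Main.v *)
(** Lower bound.  A homeomorphism from |K| to the projective plane lifts to a
    double cover of |K| by the sphere, whose monodromy is a sign on each edge of K;
    every triangle has sign product 1, and by flagness this holds for every
    3-clique of the 1-skeleton.  A signed graph on at most 10 vertices in which all
    triangles are balanced can be split into two vertex sets inducing balanced
    graphs.  Such a splitting turns the barycentric coordinates into an odd map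
    from the sphere to the circle, made of the signed vectors e_1 and e_2, against
    the Borsuk-Ulam theorem.  Both the monodromy and Borsuk-Ulam are handled at a
    finite scale: by uniform continuity it suffices to transport along sampled
    segments, and a labelling by the four vectors +-e_1, +-e_2 without opposite
    labels at nearby points has an integral "turning" cocycle.

    Upper bound.  A centrally symmetric simplicial polytope in R^3 with 22 vertices
    is exhibited, whose quotient by the antipodal map is a flag complex with 11
    vertices.  Radial projection of the polytope is expressed through the even
    moments u u^T / |u|^2, which embed both |K| and the projective plane in the
    same Euclidean space with the same image. *)

Require Import Defs.
From mathcomp Require Import all_boot all_order all_algebra reals.
From mathcomp Require Import generic_quotient.
From mathcomp Require Import zify.
From mathcomp Require Import boolp.

Set Implicit Arguments.
Unset Strict Implicit.
Unset Printing Implicit Defensive.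

(** * Signed graphs on at most ten vertices *)

(** Ten is the limit of a counting argument. Closed neighbourhoods are balanced, because every edge
    in one closes a triangle with the centre, and so are all sets of at most three vertices. A
    minimal graph without a splitting on at most ten vertices is thereby squeezed, with one exchange
    argument, to a 4-regular graph on ten vertices. Splittings help because, over a balanced part,
    the numbering of the two sheets can be switched so that it no longer depends on the vertex from
    which it is read; two parts then give only four labels, and the circle is a large enough target.
    The topological obstacle is that no lift of |K| to the sphere is continuous. An arbitrary lift
    is used: the square of the inner product of two lifted points is blind to the choice, and where
    it is large the sign of the inner product is a cocycle. *)

Section SignedGraph.
Variables (T : finType) (e x : rel T).
Hypothesis e_sym : symmetric e.
Hypothesis e_irr : irreflexive e.
Hypothesis x_sym : symmetric x.
Hypothesis x_tri : forall u v w, e u v -> e v w -> e u w -> x u v (+) x v w = x u w.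
Implicit Types (A B S M : {set T}) (u v w : T).

(** Balance in the sense of Harary, with [true] as the negative sign: switching by [c] makes every
    edge inside [A] positive. *)
Definition compat (c : T -> bool) A :=
  {in A &, forall u v, e u v -> x u v = c u (+) c v}.
Definition balanced A := exists c, compat c A.
Definition nbrs A v := [set u in A | e v u].

Lemma balancedS A B : A \subset B -> balanced B -> balanced A.
Proof. by move=> /subsetP s [c hc]; exists c => u v /s uB /s vB; apply: hc. Qed.

(** Switch by the signs of the edges at [v]; any other edge closes a triangle with [v]. The guard
    [u != v] is there because [x v v] is unconstrained. *)
Lemma balanced_star A v : {in A, forall u, u != v -> e v u} -> balanced A.
Proof.
move=> h; exists (fun u => (u != v) && x v u) => u w uA wA euw.
have := euw; case: (eqVneq u v) => [->|uv]; case: (eqVneq w v) => [->|wv] //=.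
- by rewrite e_irr.
- by rewrite addbF x_sym.
- by rewrite -(x_tri (h _ uA uv) euw (h _ wA wv)) addbA addbb.
Qed.

Lemma balancedU1 A v c b : compat c A ->
  {in nbrs A v, forall u, x v u = c u (+) b} -> balanced (v |: A).
Proof.
move=> hc h; exists (fun u => if u == v then b else c u) => u w.
have {}h z : z \in A -> e v z -> x v z = c z (+) b.
  by move=> zA ez; apply: h; rewrite inE zA.
case: (eqVneq u v) => [->|uv]; case: (eqVneq w v) => [->|wv] //=;
  rewrite ?inE ?eqxx ?(negPf uv) ?(negPf wv) //=.
- by rewrite e_irr.
- by move=> _ wA ew; rewrite addbC h.
- by move=> uA _ eu; rewrite x_sym h // e_sym.
- exact: hc.
Qed.

Lemma balanced_pendant A v : (#|nbrs A v| <= 1)%N -> balanced A -> balanced (v |: A).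
Proof.
move=> le1 [c hc].
case: (set_0Vmem (nbrs A v)) => [n0|[w wN]].
  by apply: (@balancedU1 _ _ c false) => // u; rewrite n0 inE.
apply: (@balancedU1 _ _ c (c w (+) x v w)) => // u uN.
have /cards1P[z hz] : #|nbrs A v| == 1%N.
  by rewrite eqn_leq le1 card_gt0; apply/set0Pn; exists w.
move: uN wN; rewrite hz !inE => /eqP-> /eqP->.
by rewrite addbA addbb.
Qed.


(** [M] is an inclusion-minimal unbalanced subset. A vertex with at most one neighbour in [M] could
    be deleted, and one adjacent to all others would make [M] balanced by [balanced_star]. *)
Lemma unbalanced_core B : ~ balanced B ->
  exists M, [/\ M \subset B, ~ balanced M,
    {in M, forall b, balanced (M :\ b)}, {in M, forall b, 2 <= #|nbrs M b|}
    & {in M, forall b, #|nbrs M b| + 2 <= #|M|}]%N.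
Proof.
move=> nB.
have [M /minsetP[/asboolPn nM minM] sMB] :=
  @minset_exists _ (fun A => ~~ `[<balanced A>]) B (introT (asboolPn _) nB).
have balM b : b \in M -> balanced (M :\ b).
  move=> bM; apply: contrapT => nb.
  have := minM (M :\ b) (introT (asboolPn _) nb) (subsetDl _ _).
  by move=> /setP/(_ b); rewrite !inE eqxx bM.
exists M; split=> // b bM.
  rewrite ltnNge; apply/negP => le1; apply: nM; rewrite -(setD1K bM).
  apply: balanced_pendant (balM _ bM); apply: leq_trans le1.
  by apply: subset_leq_card; apply/subsetP => u; rewrite !inE => /andP[/andP[_ ->] ->].
rewrite addn2; rewrite leqNgt; apply/negP => lt; apply: nM.
apply: (@balanced_star _ b) => u uM ub.
have : nbrs M b == M :\ b.
  rewrite eqEcard; apply/andP; split.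
    apply/subsetP => w; rewrite !inE => /andP[-> ew]; rewrite andbT.
    by apply: contraL ew => /eqP->; rewrite e_irr.
  by move: (cardsD1 b M); rewrite bM; lia.
by move=> /eqP/setP/(_ u); rewrite !inE ub uM /=.
Qed.

Lemma unbalanced_card B : ~ balanced B -> (4 <= #|B|)%N.
Proof.
move=> /unbalanced_core[M [sMB nM _ deg2 deg]].
have [M0|[b bM]] := set_0Vmem M.
  by case: nM; exists (fun=> false) => u v; rewrite M0 inE.
have := deg2 _ bM; have := deg _ bM; have := subset_leq_card sMB; lia.
Qed.

Lemma unbalanced4 B b : ~ balanced B -> #|B| = 4%N -> b \in B -> #|nbrs B b| = 2%N.
Proof.
move=> nB B4 bB; have [M [sMB nM _ deg2 deg]] := unbalanced_core nB.
have MB : M = B.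
  by apply/eqP; rewrite eqEcard sMB B4; apply: unbalanced_card.
by subst M; have := deg2 _ bB; have := deg _ bB; lia.
Qed.

Definition bisplit S := exists A, [/\ A \subset S, balanced A & balanced (S :\: A)].

Lemma nbrs_sub A v : nbrs A v \subset A.
Proof. by apply/subsetP => u; rewrite inE => /andP[]. Qed.

Lemma nbrsS A B v : A \subset B -> nbrs A v \subset nbrs B v.
Proof. by move=> /subsetP s; apply/subsetP => u; rewrite !inE => /andP[/s-> ->]. Qed.

Lemma card_nbrsD A S v : A \subset S -> #|nbrs S v| = (#|nbrs A v| + #|nbrs (S :\: A) v|)%N.
Proof.
move=> sAS; rewrite -cardsUI -[LHS]addn0; congr addn.
  apply: eq_card => u; rewrite !inE.
  by case: (boolP (u \in A)) => [/(subsetP sAS)->|]; rewrite ?orbF //= andbT.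
by apply/esym/eqP; rewrite cards_eq0 -subset0; apply/subsetP => u;
   rewrite !inE; case: (u \in A); rewrite ?andbF.
Qed.

(** * Minimal signed graphs without a balanced splitting *)

Section Critical.
Variable S : {set T}.
Hypothesis nS : ~ bisplit S.
Hypothesis minS : {in S, forall v, bisplit (S :\ v)}.
Hypothesis S10 : (#|S| <= 10)%N.

Lemma bal_compl A : A \subset S -> balanced A -> ~ balanced (S :\: A).
Proof. by move=> sAS bA bS; apply: nS; exists A. Qed.

Lemma bal_card A : A \subset S -> balanced A -> (#|A| + 4 <= #|S|)%N.
Proof.
move=> sAS bA; have := unbalanced_card (bal_compl sAS bA).
by have := subset_leq_card sAS; rewrite cardsDS //; lia.
Qed.

(** With at most three neighbours, [v] would have at most one in some half of a splitting of
    [S :\ v] and could join that half as a pendant vertex. *)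
Lemma deg_ge4 v : v \in S -> (4 <= #|nbrs S v|)%N.
Proof.
move=> vS; have [A [sA bA bA']] := minS vS.
have eS : #|nbrs S v| = #|nbrs (S :\ v) v|.
  apply: eq_card => u; rewrite !inE.
  by case: (eqVneq u v) => [->|//]; rewrite e_irr !andbF.
rewrite leqNgt; apply/negP; rewrite eS (card_nbrsD _ sA) => lt.
have [le1|le1] : (#|nbrs A v| <= 1 \/ #|nbrs ((S :\ v) :\: A) v| <= 1)%N by lia.
  apply: nS; exists (v |: A); split; last 2 first.
  - exact: balanced_pendant.
  - apply: balancedS bA'; apply/subsetP => u; rewrite !inE negb_or => /andP[/andP[-> ->] ->] //.
  rewrite subUset sub1set vS; apply: subset_trans sA (subsetDl _ _).
apply: nS; exists A; split => //; first exact: subset_trans sA (subsetDl _ _).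
apply: balancedS (balanced_pendant le1 bA'); apply/subsetP => u; rewrite !inE.
by case: eqP => //= _ /andP[-> ->].
Qed.

Definition cnbrs v := v |: nbrs S v.

Lemma cnbrs_sub v : v \in S -> cnbrs v \subset S.
Proof. by move=> vS; rewrite subUset sub1set vS nbrs_sub. Qed.

Lemma cnbrs_bal v : balanced (cnbrs v).
Proof.
apply: (@balanced_star _ v) => u; rewrite !inE => /orP[->//|/andP[_ ->]] //.
Qed.

Lemma cnbrs_card v : #|cnbrs v| = #|nbrs S v|.+1.
Proof. by rewrite cardsU1 inE e_irr andbF. Qed.

Lemma deg_le v : v \in S -> (#|nbrs S v| + 5 <= #|S|)%N.
Proof.
by move=> vS; have := bal_card (cnbrs_sub vS) (cnbrs_bal v); rewrite cnbrs_card; lia.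
Qed.

(* The complement [B] of [A] would be an unbalanced 4-cycle.  After switching [A] to
   be positive, every [b] in [B] has at most three neighbours in [A], of both signs;
   exchanging [b] with a neighbour [a b] of minority sign shows that [a b] is adjacent
   to all of [B] but the vertex opposite to [b].  The triangles [b, b', a b] then
   determine the signs of [B] and make it balanced. *)
Lemma no_compl4 A : A \subset S -> balanced A -> #|S :\: A| <> 4%N.
Proof.
move=> sAS bA; set B := S :\: A => B4.
have nB := bal_compl sAS bA; rewrite -/B in nB.
have BS b : b \in B -> b \in S by rewrite inE => /andP[].
have deg2 b : b \in B -> #|nbrs B b| = 2%N := unbalanced4 nB B4.
have degA b : b \in B -> (#|nbrs A b| <= 3)%N.
  move=> bB; have := deg_le (BS _ bB); rewrite (card_nbrsD _ sAS) -/B deg2 //; lia.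
have [op opP] : exists op : T -> T, forall b, b \in B -> B :\ b :\: nbrs B b = [set op b].
  have h b : exists o, b \in B -> B :\ b :\: nbrs B b = [set o].
    case: (boolP (b \in B)) => [bB|_]; last by exists b.
    suff /cards1P[o ->] : #|B :\ b :\: nbrs B b| == 1%N by exists o.
    rewrite cardsDS ?deg2 //; first by move: (cardsD1 b B); rewrite bB B4; lia.
    apply/subsetP => w; rewrite !inE => /andP[-> ew]; rewrite andbT.
    by apply: contraL ew => /eqP->; rewrite e_irr.
  by exists (fun b => projT1 (cid (h b))) => b; case: (cid (h b)).
have opE b u : b \in B -> (u == op b) = [&& u \in B, u != b & ~~ e b u].
  move=> /opP/setP/(_ u); rewrite !inE => <-.
  by case: (u == b) => //=; [rewrite !andbF|]; case: (u \notin A); case: (u \in S); case: (e b u).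
have opB b : b \in B -> op b \in B.
  by move=> bB; have := opE _ (op b) bB; rewrite eqxx => /esym/and3P[].
have eB b u : b \in B -> u \in B -> e b u = (u != b) && (u != op b).
  move=> bB uB; rewrite opE // uB /=; case: (eqVneq u b) => [->|_] /=; first exact: e_irr.
  by rewrite negbK.
have [c hc] := bA.
pose y b u := x b u (+) c u.
have minority b : b \in B -> exists a, [/\ a \in A, e b a &
    {in nbrs A b, forall u, u != a -> y b u = ~~ y b a}].
  move=> bB.
  have nb : ~ balanced (b |: A).
    move=> bb; have sb : b |: A \subset S by rewrite subUset sub1set BS.
    have := bal_card sb bb; have := cardsD S A; rewrite -/B B4 (setIidPr sAS) cardsU1.
    have /negPf-> : b \notin A by move: bB; rewrite inE => /andP[].
    by have := subset_leq_card sAS; lia.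
  pose Y k := [set u in nbrs A b | y b u == k].
  have Y0 k : (0 < #|Y k|)%N.
    rewrite lt0n cards_eq0; apply/negP => /eqP Yk.
    apply: nb; apply: (@balancedU1 _ _ c (~~ k)) => // u uN.
    move: Yk => /setP/(_ u); rewrite in_set0 inE uN /y /=.
    by case: (x b u) (c u) k => [] [] [].
  have YD : #|nbrs A b| = (#|Y true| + #|Y false|)%N.
    rewrite -cardsUI -[LHS]addn0; congr addn.
      by apply: eq_card => u; rewrite !inE; case: (y b u); rewrite ?andbT ?andbF ?orbF.
    by apply/esym/eqP; rewrite cards_eq0 -subset0; apply/subsetP => u;
       rewrite !inE; case: (y b u); rewrite !andbF.
  have [k /cards1P[a Ya]] : exists k, #|Y k| == 1%N.
    have := degA _ bB; have := Y0 true; have := Y0 false; rewrite YD.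
    case: (eqVneq #|Y true| 1%N) => [h _ _ _|h1 h2 h3 h4]; first by exists true; rewrite h.
    by exists false; apply/eqP; move/eqP: h1; lia.
  have : a \in Y k by rewrite Ya set11.
  rewrite !inE => /andP[/andP[aA ea] /eqP ya]; exists a; split => // u uN ua.
  have : u \notin Y k by rewrite Ya inE.
  by rewrite inE uN /= ya; case: (y b u) (k) => [] [].
have [a aP] : exists a : T -> T, forall b, b \in B -> [/\ a b \in A, e b (a b) &
    {in nbrs A b, forall u, u != a b -> y b u = ~~ y b (a b)}].
  have h b : exists o, b \in B -> [/\ o \in A, e b o &
    {in nbrs A b, forall u, u != o -> y b u = ~~ y b o}].
    case: (boolP (b \in B)) => [/minority[o oP]|_]; last by exists b.
    by exists o.
  by exists (fun b => projT1 (cid (h b))) => b; case: (cid (h b)).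
have aB b : b \in B -> a b \notin B by move=> /aP[aA _ _]; rewrite inE aA.
have ea b u : b \in B -> u \in B -> e (a b) u = (u != op b).
  move=> bB; have [aA eba am] := aP _ bB.
  (* Without its minority neighbour, [b] sees a single sign in [A] and can be added. The complement
     [B'] is again an unbalanced set of four vertices, so all its degrees are 2. *)
  pose A' := b |: (A :\ a b); pose B' := a b |: (B :\ b).
  have bA' : balanced A'.
    apply: (@balancedU1 _ _ c (~~ y b (a b))) => [z w|z].
      by rewrite !inE => /andP[_ zA] /andP[_ wA]; apply: hc.
    rewrite !inE => /andP[/andP[za zA] ebz].
    by rewrite -(am z) /y ?inE ?zA //= addbCA addbb addbF.
  have sA' : A' \subset S.
    by rewrite subUset sub1set BS //=; apply: subset_trans sAS; apply: subsetDl.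
  have SA' : S :\: A' = B'.
    apply/setP => w; rewrite !inE; case: (eqVneq w (a b)) => [->|wa] /=.
      rewrite (subsetP sAS) // andbT orbF; apply: contraNneq (aB _ bB) => ->//.
    by rewrite negb_or; case: (w == b); case: (w \in A).
  have nB' := bal_compl sA' bA'; rewrite SA' in nB'.
  have B'4 : #|B'| = 4%N.
    have := cardsD1 b B; rewrite bB B4 => hB.
    by rewrite cardsU1 !inE aA andbF /=; move: hB; rewrite -/B; lia.
  have d' w := unbalanced4 (b := w) nB' B'4.
  have Na : nbrs B' (a b) \subset B :\ b.
    by apply/subsetP => w; rewrite !inE;
       case: (eqVneq w (a b)) => [->|_ /andP[]]; rewrite ?e_irr ?andbF.
  (* [op b] keeps in [B'] its two neighbours in [B], hence has no third one. *)
  have eop : ~~ e (op b) (a b).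
    apply/negP => eop.
    have oB' : op b \in B'.
      have := opE b (op b) bB; rewrite eqxx => /esym/and3P[h1 h2 _].
      by rewrite in_setU1 in_setD1 h1 h2 orbT.
    have := d' _ oB'; suff: (2 < #|nbrs B' (op b)|)%N by lia.
    rewrite -(deg2 _ (opB _ bB)); apply: proper_card; apply/properP; split.
      apply/subsetP => w; rewrite inE => /andP[wB ew]; rewrite inE ew andbT.
      rewrite in_setU1 in_setD1 wB andbT; apply/orP; right.
      apply: contraL ew => /eqP->; rewrite e_sym.
      by have := opE b (op b) bB; rewrite eqxx => /esym/and3P[].
    exists (a b); first by rewrite inE in_setU1 eqxx.
    by rewrite inE (negPf (aB _ bB)).
  have Nb : nbrs B' (a b) = B :\ b :\ op b.
    apply/eqP; rewrite eqEcard; apply/andP; split.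
      rewrite subsetD1 Na inE e_sym (negPf eop) andbF //.
    rewrite d' ?in_setU1 ?eqxx //.
    have := cardsD1 b B; have := cardsD1 (op b) (B :\ b); rewrite bB B4.
    have := opE b (op b) bB; rewrite eqxx => /esym/and3P[h1 h2 _].
    by rewrite in_setD1 h1 h2; lia.
  move=> uB; case: (eqVneq u b) => [->|ub].
    rewrite e_sym eba; apply/esym; have := opE b b bB; rewrite eqxx andbF => ->//.
  have /setP/(_ u) := Nb; rewrite in_setD1 in_setD1 inE in_setU1 in_setD1 uB ub orbT /=.
  by rewrite andbT.
have opK b : b \in B -> op (op b) = b.
  move=> bB; apply/esym/eqP; rewrite opE ?opB // bB eq_sym e_sym.
  by have := opE b (op b) bB; rewrite eqxx => /esym/and3P[_ -> ->].
have ainj : {in B &, injective a}.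
  move=> b b' bB b'B eqa.
  have := ea b (op b) bB (opB _ bB); rewrite eqxx eqa ea ?opB // => /negbFE/eqP h.
  by rewrite -(opK _ bB) h opK.
have xB b b' : b \in B -> b' \in B -> e b b' -> x b b' = y b (a b) (+) ~~ y b' (a b').
  move=> bB b'B ebb'.
  have [_ eba _] := aP _ bB; have [_ _ am'] := aP _ b'B; have [aA _ _] := aP _ bB.
  have nb' : b' != op b by move: ebb'; rewrite eB // => /andP[].
  have eab' : e (a b) b' by rewrite ea.
  rewrite -(x_tri eba eab' ebb') (x_sym (a b)).
  rewrite -(am' (a b)); first by rewrite /y; case: (x b _) (x b' _) (c _) => [] [] [].
    by rewrite inE aA e_sym.
  by apply/eqP => /(ainj _ _ bB b'B) bb; move: ebb'; rewrite bb e_irr.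
apply: nB.
have [B0|[b0 b0B]] := set_0Vmem B; first by rewrite B0 cards0 in B4.
(* By [xB], switching by [y b (a b)] makes every edge of [B] negative; the bipartition [t] of the
   4-cycle corrects this. *)
pose t b := (b == b0) || (b == op b0).
exists (fun b => y b (a b) (+) t b) => b b' bB b'B ebb'; rewrite xB //.
suff -> : t b' = ~~ t b by case: (y b _) (y b' _) (t b) => [] [] [].
move: (ebb'); rewrite eB // => /andP[h1 h2]; rewrite /t.
case: (eqVneq b b0) => [bb|bb] /=; first by rewrite -bb (negPf h1) (negPf h2).
case: (eqVneq b (op b0)) => [bo|bo] /=.
  by rewrite bo opK // in h1 h2; rewrite (negPf h1) (negPf h2).
apply: contraT; rewrite negb_or => /andP[b'b b'o].
have ob : op b0 != b0 by have := opE b0 (op b0) b0B; rewrite eqxx => /esym/and3P[].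
suff : (#|[set b0; op b0; b']| <= #|nbrs B b|)%N.
  rewrite deg2 // -setUA cardsU1 cards2 !inE (eq_sym b0) (negPf ob) /=.
  by rewrite (eq_sym b0) (eq_sym _ b') (negPf b'b) (negPf b'o).
have neB z : z \in B -> b != z -> b != op z -> z \in nbrs B b.
  move=> zB bz boz; rewrite inE zB eB // eq_sym bz /=.
  by apply: contraNneq boz => ->; rewrite opK.
rewrite subset_leq_card // !subUset !sub1set (neB b0) // (neB (op b0)) ?opB ?opK //.
by rewrite inE b'B.
Qed.


(** Degree [#|S| - 5], the maximum in [deg_le], would leave a complement of four vertices, against
    [no_compl4]. So degrees are at most [#|S| - 6 <= 4], and [deg_ge4] turns both bounds into
    equalities. *)
Lemma critical_regular : #|S| = 10%N /\ {in S, forall v, #|nbrs S v| = 4%N}.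
Proof.
have key v : v \in S -> #|S| = 10%N /\ #|nbrs S v| = 4%N.
  move=> vS; have := no_compl4 (cnbrs_sub vS) (cnbrs_bal v).
  rewrite cardsDS ?cnbrs_sub // cnbrs_card.
  by have := deg_le vS; have := deg_ge4 vS; lia.
split; last by move=> v /key[].
have [S0|[v /key[]//]] := set_0Vmem S.
case: nS; exists set0; split; rewrite ?sub0set //;
  by exists (fun=> false) => u v; rewrite ?S0 ?set0D inE.
Qed.

Lemma unbalanced_ge6 A : A \subset S -> (6 <= #|A|)%N -> ~ balanced A.
Proof.
move=> sAS A6 bA; have [S10' _] := critical_regular.
have := no_compl4 sAS bA; have := bal_card sAS bA.
by rewrite cardsDS //; lia.
Qed.

(* The five non-neighbours of a vertex induce an unbalanced graph of degree at most 2: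
   a 5-cycle, or a 4-cycle and an isolated vertex. *)
Lemma no_critical : False.
Proof.
have [S10' deg4] := critical_regular.
have /card_gt0P[v vS] : (0 < #|S|)%N by rewrite S10'.
pose N := nbrs S v; pose B := S :\: cnbrs v.
have sN := cnbrs_sub vS.
have B5 : #|B| = 5%N by rewrite cardsDS // cnbrs_card deg4 // S10'.
have nB : ~ balanced B := bal_compl sN (cnbrs_bal v).
have BP u : u \in B -> [/\ u \in S, u != v & ~~ e v u].
  by rewrite !inE negb_or => /andP[/andP[-> h] uS]; move: h; rewrite uS.
have sBS : B \subset S by apply: subsetDl.
have nbN u : u \in B -> nbrs (cnbrs v) u = nbrs N u.
  move=> /BP[_ uv evu]; apply/setP => w; rewrite !inE.
  by case: (eqVneq w v) => [->|//]; rewrite e_irr e_sym (negPf evu) !andbF.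
have degN u : u \in B -> (2 <= #|nbrs N u|)%N.
  move=> uB; rewrite ltnNge; apply/negP; rewrite -nbN // => le1.
  have [uS uv evu] := BP u uB.
  have := balanced_pendant le1 (cnbrs_bal v); apply: unbalanced_ge6.
    by rewrite subUset sub1set uS.
  by rewrite cardsU1 cnbrs_card deg4 //; move: uB; rewrite inE => /andP[-> _].
have degNB u : u \in B -> (#|nbrs N u| + #|nbrs B u| = 4)%N.
  by move=> uB; rewrite -nbN // -card_nbrsD // deg4 // (subsetP sBS).
have NP a : a \in N -> a \in S /\ e v a by rewrite inE => /andP[].
have degaB a : a \in N -> (#|nbrs B a| <= 3)%N.
  move=> /NP[aS eva]; have := deg4 _ aS; rewrite (cardsD1 v) inE vS e_sym eva add1n.
  move=> [<-]; apply: subset_leq_card; apply/subsetP => u; rewrite inE => /andP[/BP[uS uv _] eau].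
  by rewrite !inE uv uS.
have BaD b : b \in B -> #|B :\ b| = 4%N by move=> bB; have := cardsD1 b B; rewrite bB B5; lia.
(* Adding [v], whose only neighbour in this set is [a], would give six balanced vertices. *)
have key a b : a \in N -> b \in B -> ~ balanced (a |: B :\ b).
  move=> aN bB /(@balanced_pendant _ v) h.
  have [aS eva] := NP _ aN.
  apply: (unbalanced_ge6 _ _ (h _)).
  - by rewrite !subUset !sub1set vS aS; apply: subset_trans sBS; apply: subsetDl.
  - rewrite !cardsU1 BaD // !inE eqxx !andbF !orbF.
    have /negPf-> : v != a by apply: contraTneq eva => ->; rewrite e_irr.
    by move: aN; rewrite inE => ->; rewrite orbT !andbF.
  - rewrite -(cards1 a); apply: subset_leq_card; apply/subsetP => u.
    rewrite in_set1 [u \in nbrs _ _]inE in_setU1; case: (eqVneq u a) => //= _.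
    by rewrite in_setD1 => /andP[/andP[_ /BP[_ _ /negPf->]]].
have [M [sMB nM balM degM _]] := unbalanced_core nB.
have nbM u : u \in M -> nbrs M u = nbrs B u.
  move=> uM; have uB := subsetP sMB _ uM.
  apply/eqP; rewrite eqEcard nbrsS //=.
  by apply: leq_trans (degM _ uM); have := degN _ uB; have := degNB _ uB; lia.
have /card_gt0P[a0 a0N] : (0 < #|N|)%N by rewrite deg4.
have [MB|nMB] := eqVneq M B.
  subst M.
  (* The 5-cycle: each of the four vertices of [N] has three neighbours in [B], each of the five
     vertices of [B] has two in [N], and 12 is not 10. *)
  have K3 a : a \in N -> #|nbrs B a| = 3%N.
    move=> aN; have K2 b : b \in B -> (2 <= #|nbrs (B :\ b) a|)%N.
      move=> bB; rewrite ltnNge; apply/negP => le1.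
      by apply: (key _ _ aN bB); apply: balanced_pendant le1 (balM _ bB).
    have /card_gt0P[b0 b0B] : (0 < #|B|)%N by rewrite B5.
    have /card_gt0P[b bK] : (0 < #|nbrs (B :\ b0) a|)%N by apply: leq_trans (K2 _ b0B).
    have {b0 b0B bK}bK : b \in nbrs B a by move: bK; rewrite !inE => /andP[/andP[_ ->] ->].
    apply/eqP; rewrite eqn_leq degaB // (cardsD1 b) bK add1n ltnS.
    apply: leq_trans (K2 b _) _; first by move: bK; rewrite inE => /andP[].
    apply: subset_leq_card; apply/subsetP => u; rewrite !in_setD1 !inE.
    by move=> /andP[/andP[-> ->] ->].
  have K2 u : u \in B -> #|nbrs N u| = 2%N.
    by move=> uB; have := degM _ uB; have := degN _ uB; have := degNB _ uB; lia.
  have cardE A u : #|nbrs A u| = (\sum_(w in A) e u w)%N.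
    rewrite -sum1_card big_mkcond [RHS]big_mkcond /=; apply: eq_bigr => w _.
    by rewrite inE; case: (w \in A); case: (e u w).
  have : (\sum_(a in N) #|nbrs B a| = \sum_(u in B) #|nbrs N u|)%N.
    rewrite (eq_bigr _ (fun a _ => cardE B a)) exchange_big /=; apply: eq_bigr => u _.
    by rewrite cardE; apply: eq_bigr => a _; rewrite e_sym.
  by rewrite (eq_bigr _ K3) (eq_bigr _ K2) !sum_nat_const B5 deg4.
have M4 : #|M| = 4%N.
  have := unbalanced_card nM; have := proper_card (A := M) (B := B).
  by rewrite properEneq nMB sMB B5 => /(_ isT); lia.
have /cards1P[z Bz] : #|B :\: M| == 1%N by rewrite cardsDS // B5 M4.
have : z \in B :\: M by rewrite Bz set11.
rewrite in_setD => /andP[zM zB].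
have BzE u : u \in B -> u = z \/ u \in M.
  by move=> uB; case: (boolP (u \in M)) => uM; [right|left; apply/set1P; rewrite -Bz in_setD uM].
have ezM u : u \in M -> e z u = false.
  move=> uM; apply/negP => ezu; have : z \in nbrs B u by rewrite inE zB e_sym.
  by rewrite -nbM // inE (negPf zM).
(* The isolated vertex [z] must be adjacent to all of [N], so [a0] has at most two neighbours on the
   4-cycle. Deleting one of them makes [a0] pendant, and [z] pendant to [a0], against [key]. *)
have ezN : e z a0.
  have : nbrs N z == N.
    rewrite eqEcard nbrs_sub deg4 //=; have := degNB _ zB.
    suff -> : nbrs B z = set0 by rewrite cards0; lia.
    apply/setP => u; rewrite inE in_set0; apply/andP => -[/BzE[->|/ezM->//]].
    by rewrite e_irr.
  by move=> /eqP/setP/(_ a0); rewrite inE a0N /= => ->.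
have nb2 : (#|nbrs M a0| <= 2)%N.
  have := degaB _ a0N; rewrite (cardsD1 z) inE zB e_sym ezN add1n ltnS; apply: leq_trans.
  apply: subset_leq_card; apply/subsetP => u; rewrite inE => /andP[uM eu].
  rewrite in_setD1 [u \in nbrs _ _]inE (subsetP sMB) // eu andbT.
  by rewrite andbT; apply: contraNneq zM => <-.
have [b [bM le1]] : exists b, b \in M /\ (#|nbrs (M :\ b) a0| <= 1)%N.
  have /card_gt0P[b0 b0M] : (0 < #|M|)%N by rewrite M4.
  have [K0|[b bK]] := set_0Vmem (nbrs M a0).
    exists b0; split=> //; apply: (leq_trans (subset_leq_card (nbrsS _ (subsetDl _ _)))).
    by rewrite K0 cards0.
  exists b; split; first by move: bK; rewrite inE => /andP[].
  move: nb2; rewrite (cardsD1 b) bK add1n ltnS; apply: leq_trans.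
  apply: subset_leq_card; apply/subsetP => u; rewrite !inE.
  by move=> /andP[/andP[-> ->] ->].
apply: (key a0 b a0N (subsetP sMB _ bM)).
have h := balanced_pendant le1 (balM _ bM).
apply: balancedS (balanced_pendant (v := z) _ h); last first.
  rewrite -(cards1 a0); apply: subset_leq_card; apply/subsetP => u.
  rewrite in_set1 [u \in nbrs _ _]inE in_setU1.
  by case: (eqVneq u a0) => //= _; rewrite in_setD1 => /andP[/andP[_ /ezM->]].
apply/subsetP => u; rewrite !in_setU1 !in_setD1 => /orP[->|/andP[ub /BzE[->|uM]]].
- by rewrite orbT.
- by rewrite eqxx.
- by rewrite ub uM !orbT.
Qed.

End Critical.

Theorem bisplit_small S : (#|S| <= 10)%N -> bisplit S.
Proof.
have [n ltn] := ubnP #|S|; elim: n S ltn => // n IH S ltn S10.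
apply: contrapT => nS; apply: (@no_critical S nS) => // v vS.
by have := cardsD1 v S; rewrite vS => h; apply: IH; lia.
Qed.

End SignedGraph.

(** * Transport of cocycles along sampled segments *)

From mathcomp Require Import classical_sets functions cardinality topology.
From mathcomp Require Import normedtype derive.
From mathcomp Require Import ring lra.

Import Order.TTheory GRing.Theory Num.Theory.
Import numFieldNormedType.Exports.
Local Open Scope classical_set_scope.
Local Open Scope ring_scope.
Local Open Scope quotient_scope.

Section Transport.
Variables (R : realType) (I : Type) (A : zmodType).
Implicit Types s t c : I -> R.

Definition near (d : R) s t := forall i, `|s i - t i| <= d.

Lemma near_le d d' s t : d <= d' -> near d s t -> near d' s t.
Proof. by move=> dd h i; apply: le_trans dd. Qed.

Lemma near_trans d d' s t u : near d s t -> near d' t u -> near (d + d') s u.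
Proof.
move=> h h' i; rewrite (_ : s i - u i = (s i - t i) + (t i - u i)); last by ring.
by rewrite (le_trans (ler_normD _ _)) ?lerD.
Qed.

Variables (D : (I -> R) -> Prop) (a : (I -> R) -> (I -> R) -> A) (d : R) (N : nat).
Hypothesis a_cocycle : forall s t u, D s -> D t -> D u ->
  near d s t -> near d t u -> near d s u -> a s t + a t u = a s u.
Hypothesis d_gt0 : 0 < d.
Hypothesis N_large : 4 <= d * N%:R.

Lemma cocycle_refl s : D s -> a s s = 0.
Proof.
move=> Ds; have h : near d s s by move=> i; rewrite subrr normr0 ltW.
by apply: (addrI (a s s)); rewrite addr0 a_cocycle.
Qed.

Definition seg c s k : I -> R := fun i => s i + k%:R / N%:R * (c i - s i).
Definition transport c s := \sum_(k < N) a (seg c s k) (seg c s k.+1).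

Lemma N_gt0 : 0 < N%:R :> R.
Proof.
by rewrite ltr0n lt0n; apply/negP => /eqP N0; move: N_large; rewrite N0 mulr0; lra.
Qed.

Lemma seg0 c s : seg c s 0 = s.
Proof. by apply/funext => i; rewrite /seg mul0r mul0r addr0. Qed.

Lemma segN c s : seg c s N = c.
Proof.
apply/funext => i; rewrite /seg divff ?mul1r; first by rewrite addrC subrK.
by rewrite gt_eqF // N_gt0.
Qed.

Definition unitbox s := forall i, `|s i| <= 1.

Lemma seg_ratio k : (k <= N)%N -> 0 <= (k%:R / N%:R : R) <= 1.
Proof.
move=> kN; apply/andP; split; first by rewrite divr_ge0.
by rewrite ler_pdivrMr ?N_gt0 // mul1r ler_nat.
Qed.

Lemma seg_near_sides c s s' k : (k <= N)%N -> near (d / 2) s s' ->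
  near (d / 2) (seg c s k) (seg c s' k).
Proof.
move=> /seg_ratio /andP[h0 h1] h i; rewrite /seg; set u := k%:R / N%:R in h0 h1 *.
rewrite (_ : _ - _ = (1 - u) * (s i - s' i)); last by ring.
rewrite normrM ger0_norm ?subr_ge0 //.
by have := h i; have := normr_ge0 (s i - s' i); nra.
Qed.

(** Coordinates in the box differ by at most 2, so a step is at most [2 / N]; the 4 in [N_large]
    makes this [d / 2]. *)
Lemma seg_near_step c s k : unitbox c -> unitbox s ->
  near (d / 2) (seg c s k) (seg c s k.+1).
Proof.
move=> bc bs i; rewrite /seg.
rewrite (_ : _ - _ = - (N%:R^-1 * (c i - s i))); last by rewrite mulrSr; ring.
rewrite normrN normrM ger0_norm ?invr_ge0 // mulrC ler_pdivrMr ?N_gt0 //.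
have := le_trans (ler_normB (c i) (s i)) (lerD (bc i) (bs i)).
by move: N_large; lra.
Qed.

(** A discrete Stokes formula: the squares commute, so the interior rungs cancel. *)
Lemma ladder (s s' : nat -> I -> R) n :
  (forall k, (k < n)%N -> a (s k) (s k.+1) + a (s k.+1) (s' k.+1) =
                        a (s k) (s' k) + a (s' k) (s' k.+1)) ->
  \sum_(k < n) a (s k) (s k.+1) + a (s n) (s' n) =
  a (s 0) (s' 0) + \sum_(k < n) a (s' k) (s' k.+1).
Proof.
elim: n => [_|n IH h]; first by rewrite !big_ord0 addr0 add0r.
rewrite !big_ord_recr /= -addrA h // addrA IH ?addrA // => k kn.
by apply: h; apply: ltnW.
Qed.

(** Both segments end at [c], so the last rung vanishes. A diagonal cuts each square into two
    cocycle relations; sides and rungs within [d / 2] keep it within [d]. Up to sign, [transport c]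
    is thus a primitive of [a]. *)
Lemma transport_near c s s' :
  (forall k, (k <= N)%N -> D (seg c s k)) -> (forall k, (k <= N)%N -> D (seg c s' k)) ->
  unitbox c -> unitbox s -> unitbox s' -> near (d / 2) s s' ->
  transport c s = a s s' + transport c s'.
Proof.
move=> Ds Ds' bc bs bs' ss'.
have Dc : D c by have := Ds N (leqnn N); rewrite segN.
have := @ladder (seg c s) (seg c s') N; rewrite !seg0 !segN (cocycle_refl Dc) addr0; apply.
move=> k kN; have kN' := ltnW kN.
have hd : d = d / 2 + d / 2 := splitr d.
have dd : d / 2 <= d by rewrite {2}hd lerDl; apply: divr_ge0 => //; apply: ltW.
have n1 := seg_near_step k bc bs; have n2 := seg_near_step k bc bs'.
have n3 := seg_near_sides c kN' ss'; have n4 := seg_near_sides c kN ss'.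
have n5 : near d (seg c s k) (seg c s' k.+1) by rewrite hd; exact: near_trans n1 n4.
by rewrite !a_cocycle //; try exact: near_le dd _; auto.
Qed.

End Transport.

(* Labels are the signed unit vectors of the plane, (i, b) standing for (-1)^b e_i;
   [code] numbers them counterclockwise and [turn] is the signed angle between two
   labels that are not opposite, in quarter turns. *)
Section Labels.
Definition opp_label (l : bool * bool) := (l.1, ~~ l.2).
Definition code (l : bool * bool) : int := (l.1 : nat)%:Z + 2 * (l.2 : nat)%:Z.
Definition turn (l m : bool * bool) : int :=
  if l.1 == m.1 then 0 else if l.1 (+) l.2 (+) m.2 then -1 else 1.

(** Among three pairwise non-opposite labels at most two are distinct, so no full turn can arise. *)
Lemma turn_cocycle l m n : m <> opp_label l -> n <> opp_label m -> n <> opp_label l ->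
  turn l m + turn m n = turn l n.
Proof. by case: l => [] [] []; case: m => [] [] []; case: n => [] [] []. Qed.

Lemma turn_opp l m : turn (opp_label l) (opp_label m) = turn l m.
Proof. by case: l => [] [] []; case: m => [] [] []. Qed.

Lemma turn_code l m : m <> opp_label l ->
  exists k : int, turn l m = code m - code l + 4 * k.
Proof.
case: l => [] [] []; case: m => [] [] [] // h;
 solve [by exists 0 | by exists 1 | by exists (-1)].
Qed.
End Labels.

(** * A discrete Borsuk-Ulam theorem on the disc *)

Section BorsukUlam.
Variable R : realType.
Implicit Type p q : bool -> R.
Definition disc p := p true ^+ 2 + p false ^+ 2 <= 1.
Definition oppf p : bool -> R := fun i => - p i.

Lemma disc_unitbox p : disc p -> unitbox p.
Proof.
rewrite /disc => h; have h1 := sqr_ge0 (p true); have h2 := sqr_ge0 (p false).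
by case; rewrite ler_norml; apply/andP; split; nra.
Qed.


(** The square root is Hoelder of exponent 1/2, whence the squared scales below. *)
Lemma sqrt_dist (a b e : R) : 0 <= a -> 0 <= b -> 0 <= e -> `|a - b| <= e ^+ 2 ->
  `|Num.sqrt a - Num.sqrt b| <= e.
Proof.
move=> a0 b0 e0; rewrite -{1}(sqr_sqrtr a0) -{1}(sqr_sqrtr b0).
have := sqrtr_ge0 a; have := sqrtr_ge0 b.
move: (Num.sqrt a) (Num.sqrt b) => x y y0 x0; rewrite !ler_norml => /andP[h1 h2].
by apply/andP; split; nra.
Qed.

Lemma disc_seg p c N k : disc p -> (0 < N)%N -> (k <= N)%N -> c = (fun=> 0) ->
  disc (seg N c p k).
Proof.
rewrite /disc /seg => dp N0 kN -> /=; rewrite !sub0r.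
have N0' : 0 < N%:R :> R by rewrite ltr0n.
have : (k%:R / N%:R : R) <= 1 by rewrite ler_pdivrMr // mul1r ler_nat.
have : 0 <= (k%:R / N%:R : R) by rewrite divr_ge0.
set u := k%:R / N%:R => u0 u1.
rewrite (_ : _ + _ = (1 - u) ^+ 2 * (p true ^+ 2 + p false ^+ 2)); last by ring.
have h1 := sqr_ge0 (p true); have h2 := sqr_ge0 (p false).
apply: le_trans dp; rewrite ler_piMl ?addr_ge0 //; nra.
Qed.

(** Transport to the centre gives a primitive [th] of the turning cocycle. On the boundary,
    [g p = th (oppf p) - th p] is constant under small steps since [turn] is invariant under
    negating both labels, is odd by definition, and is 2 modulo 4 since antipodal labels are
    opposite. A half circle joins [p] to [oppf p], so [g p = - g p], which is absurd. *)
Lemma discrete_borsuk_ulam_disc (lab : (bool -> R) -> bool * bool) (d : R) : 0 < d ->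
  (forall p q, disc p -> disc q -> near d p q -> lab q <> opp_label (lab p)) ->
  (forall p, p true ^+ 2 + p false ^+ 2 = 1 -> lab (oppf p) = opp_label (lab p)) ->
  False.
Proof.
move=> d0 near_lab opp_lab.
(* The first bound serves transport; the second says [4 / N <= (d / 2) ^ 2], which controls the
   square root along the half circle [q]. *)
have [N N0 [N1 N2]] : exists2 N, (0 < N)%N & 4 <= d * N%:R /\ 16 <= d ^+ 2 * N%:R.
  have hb (x : R) : 0 <= x -> x <= (Num.bound x)%:R.
    by move=> x0; apply: ltW; apply: archi_boundP.
  exists (Num.bound (4 / d) + Num.bound (16 / d ^+ 2)).+1 => //.
  have d2 : 0 < d ^+ 2 by rewrite exprn_gt0.
  have h1 := hb (4 / d) (divr_ge0 (ler0n _ _) (ltW d0)).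
  have h2 := hb (16 / d ^+ 2) (divr_ge0 (ler0n _ _) (ltW d2)).
  rewrite ler_pdivrMr // in h1; rewrite ler_pdivrMr // in h2.
  have b1 : 0 <= (Num.bound (4 / d))%:R :> R by [].
  have b2 : 0 <= (Num.bound (16 / d ^+ 2))%:R :> R by [].
  by split; rewrite (mulrSr _ (_ + _)) natrD; nra.
pose a p q := turn (lab p) (lab q).
pose o : bool -> R := fun=> 0.
have ac s t u : disc s -> disc t -> disc u -> near d s t -> near d t u -> near d s u ->
    a s t + a t u = a s u.
  by move=> *; apply: turn_cocycle; apply: near_lab.
have disc_o : disc o by rewrite /disc /o expr0n /= addr0 ler01.
pose th := transport a N o.
have thD p q : disc p -> disc q -> near (d / 2) p q -> th p = a p q + th q.
  move=> dp dq pq; apply: (transport_near ac d0 N1) => // [k kN|k kN|||].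
  - exact: disc_seg.
  - exact: disc_seg.
  - by rewrite /o; move=> i; rewrite normr0 ler01.
  - exact: disc_unitbox.
  - exact: disc_unitbox.
have th_code p : disc p -> exists k : int, th p = code (lab o) - code (lab p) + 4 * k.
  move=> dp; rewrite /th /transport.
  have -> : code (lab o) = code (lab (seg N o p N)) by rewrite (segN N1).
  have -> : code (lab p) = code (lab (seg N o p 0)) by rewrite seg0.
  have: forall k, (k < N)%N -> lab (seg N o p k.+1) <> opp_label (lab (seg N o p k)).
    move=> k kN; apply: near_lab; try by apply: disc_seg => //; apply: ltnW.
    apply: near_le (seg_near_step N1 k (disc_unitbox disc_o) (disc_unitbox dp)).
    by rewrite {2}(splitr d) lerDl divr_ge0 // ltW.
  move=> h; suff : forall n, (n <= N)%N -> exists k : int,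
      \sum_(i < n) a (seg N o p i) (seg N o p i.+1) =
      code (lab (seg N o p n)) - code (lab (seg N o p 0)) + 4 * k by move=> /(_ N (leqnn N)).
  elim=> [_|n IH nN]; first by exists 0; rewrite big_ord0; lia.
  rewrite big_ord_recr /=; have [k ->] := IH (ltnW nN).
  by rewrite /a; have [m ->] := turn_code (h n nN); exists (k + m); lia.
pose g p := th (oppf p) - th p.
have oppK p : oppf (oppf p) = p by apply/funext => i; rewrite /oppf opprK.
have gN p : g (oppf p) = - g p by rewrite /g oppK opprB.
have g_code p : p true ^+ 2 + p false ^+ 2 = 1 -> exists k : int, g p = 2 + 4 * k.
  move=> cp; have dp : disc p by rewrite /disc cp.
  have dop : disc (oppf p) by rewrite /disc /oppf !sqrrN cp.
  have [k hk] := th_code _ dp; have [m hm] := th_code _ dop.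
  rewrite /g hk hm opp_lab //; case: (lab p) => [b [|]].
    by exists (m - k); rewrite /code /=; lia.
  by exists (m - k - 1); rewrite /code /=; lia.
pose u k : R := 1 - 2 * (k%:R / N%:R).
pose q k : bool -> R := fun i => if i then u k else Num.sqrt (1 - u k ^+ 2).
have uP k : (k <= N)%N -> -1 <= u k <= 1.
  by move=> /(seg_ratio N1) /andP[h1 h2]; rewrite /u; apply/andP; split; lra.
have u2 k : (k <= N)%N -> 0 <= 1 - u k ^+ 2 by move=> /uP/andP[h1 h2]; nra.
have qc k : (k <= N)%N -> q k true ^+ 2 + q k false ^+ 2 = 1.
  by move=> kN; rewrite /q sqr_sqrtr ?u2 // addrC subrK.
have N0' : 0 < N%:R :> R by rewrite ltr0n.
have qn k : (k < N)%N -> near (d / 2) (q k) (q k.+1).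
  move=> kN; have ukD : u k - u k.+1 = 2 / N%:R by rewrite /u mulrSr; ring.
  have := uP _ kN; have := uP _ (ltnW kN) => /andP[h1 h2] /andP[h3 h4].
  case; rewrite /q.
    rewrite ukD ger0_norm ?divr_ge0 // ler_pdivrMr //; lra.
  apply: sqrt_dist; rewrite ?u2 //; [exact: ltnW| by rewrite divr_ge0 // ltW|].
  rewrite (_ : _ - _ = - ((u k - u k.+1) * (u k + u k.+1))); last by ring.
  rewrite ukD normrN normrM (ger0_norm (divr_ge0 _ _)) // -mulrA mulrC -mulrA.
  have : `|u k + u k.+1| <= 2 by rewrite ler_norml; apply/andP; split; lra.
  rewrite mulrC ler_pdivrMr //; nra.
have gq k : (k <= N)%N -> g (q k) = g (q 0).
  elim: k => // k IH kN; rewrite -IH; last exact: ltnW.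
  have c1 := qc _ kN; have c2 := qc _ (ltnW kN); have nn := qn _ kN.
  have d1 : disc (q k) by rewrite /disc c2.
  have d2 : disc (q k.+1) by rewrite /disc c1.
  have d3 : disc (oppf (q k)) by rewrite /disc /oppf !sqrrN c2.
  have d4 : disc (oppf (q k.+1)) by rewrite /disc /oppf !sqrrN c1.
  rewrite /g (thD _ _ d1 d2 nn) (thD _ _ d3 d4).
    by rewrite /a !opp_lab // turn_opp; ring.
  by move=> i; rewrite /oppf -opprD normrN; exact: nn.
have u0 : u 0%N = 1 by rewrite /u mul0r mulr0 subr0.
have uN : u N = -1 by rewrite /u divff ?gt_eqF // mulr1; ring.
have q0N : oppf (q 0%N) = q N.
  apply/funext => -[]; rewrite /oppf /q ?u0 ?uN //.
  by rewrite sqrrN expr1n subrr sqrtr0 oppr0.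
have := gq N (leqnn _); rewrite -q0N gN.
have [k ->] := g_code _ (qc 0%N (leq0n _)); lia.
Qed.

End BorsukUlam.

(** * Inner products and antipodal labellings on the sphere *)

Section Sphere.
Variable R : realType.
Implicit Types p q : 'rV[R]_3.

Definition coord p : 'I_3 -> R := p ord0.
Definition dot p q : R := \sum_(i < 3) coord p i * coord q i.

Lemma dotE p q : dot p q = coord p 0 * coord q 0 + coord p 1 * coord q 1
  + coord p 2%:R * coord q 2%:R.
Proof.
rewrite /dot !big_ord_recl big_ord0 addr0 addrA.
by congr (_ * _ + _ * _ + _ * _); congr (coord _ _); apply: val_inj.
Qed.

Lemma sphere_dot p : sphere2 R p <-> dot p p = 1.
Proof. by rewrite /sphere2 /dot /=; split=> <-; apply: eq_bigr => i _; rewrite -expr2. Qed.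

Lemma dotC p q : dot p q = dot q p.
Proof. by rewrite !dotE; ring. Qed.

Lemma dotNl p q : dot (- p) q = - dot p q.
Proof. by rewrite !dotE /coord !mxE; ring. Qed.

Lemma sphereN p : sphere2 R p -> sphere2 R (- p).
Proof. by move=> /sphere_dot h; apply/sphere_dot; rewrite dotNl dotC dotNl opprK. Qed.

Lemma sphere_neqN p : sphere2 R p -> - p != p.
Proof.
move=> /sphere_dot h; apply/eqP => pp.
by have := dotNl p p; rewrite pp h; lra.
Qed.

Lemma dot_near p q d : sphere2 R p -> sphere2 R q -> near d (coord p) (coord q) ->
  d <= 1 / 2 -> 0 < dot p q.
Proof.
move=> /sphere_dot + /sphere_dot + h hd; rewrite !dotE.
have hi i : (coord p i - coord q i) ^+ 2 <= 1 / 4.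
  have := h i; rewrite ler_norml => /andP[h1 h2]; nra.
by have := hi 0; have := hi 1; have := hi 2%:R; nra.
Qed.

(* The Gram determinant of three vectors is the square of their determinant. *)
Lemma gram_sign p q r : sphere2 R p -> sphere2 R q -> sphere2 R r ->
  1 / 2 < dot p q ^+ 2 -> 1 / 2 < dot q r ^+ 2 -> 1 / 2 < dot p r ^+ 2 ->
  (dot p q < 0) (+) (dot q r < 0) = (dot p r < 0).
Proof.
move=> /sphere_dot hp /sphere_dot hq /sphere_dot hr h1 h2 h3.
have gram : 0 <= dot p p * dot q q * dot r r + 2 * dot p q * dot q r * dot p r
    - dot p p * dot q r ^+ 2 - dot q q * dot p r ^+ 2 - dot r r * dot p q ^+ 2.
  set g := (X in 0 <= X).
  suff -> : g = (coord p 0 * (coord q 1 * coord r 2%:R - coord q 2%:R * coord r 1)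
     - coord p 1 * (coord q 0 * coord r 2%:R - coord q 2%:R * coord r 0)
     + coord p 2%:R * (coord q 0 * coord r 1 - coord q 1 * coord r 0)) ^+ 2.
    exact: sqr_ge0.
  by rewrite /g !dotE; ring.
rewrite hp hq hr in gram.
(* The determinant is now [1 + 2xyz - x^2 - y^2 - z^2], and squares above 1/2 force [xyz > 1/4]. *)
have {}gram : 0 < dot p q * dot q r * dot p r by lra.
move: gram h1 h2 h3; move: (dot p q) (dot q r) (dot p r) => x y z xyz x2 y2 z2.
have nz (u : R) : 1 / 2 < u ^+ 2 -> u != 0.
  by move=> hu; apply/eqP => u0; move: hu; rewrite u0 expr0n /=; lra.
have := nz _ x2; have := nz _ y2; have := nz _ z2; rewrite !neq_lt.
move=> /orP[] hz /orP[] hy _; move: xyz;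
  rewrite ?hy ?hz ?(lt_gtF hy) ?(lt_gtF hz) ?addbT ?addbF;
  (try rewrite (nmulr_lgt0 _ hz)); (try rewrite (pmulr_lgt0 _ hz));
  first [rewrite (nmulr_llt0 _ hy)|rewrite (pmulr_llt0 _ hy)
        |rewrite (nmulr_lgt0 _ hy)|rewrite (pmulr_lgt0 _ hy)] => hx;
  by rewrite ?hx ?(lt_gtF hx).
Qed.

Lemma sphere_e0 : sphere2 R (\row_i (i == 0)%:R).
Proof. by apply/sphere_dot; rewrite dotE /coord !mxE /=; ring. Qed.

(** The disc parametrises the upper hemisphere; [lift] commutes with negation only over the boundary
    circle, which is all that the disc version asks. *)
Theorem discrete_borsuk_ulam (lab : 'rV[R]_3 -> bool * bool) (d : R) : 0 < d ->
  (forall p q, sphere2 R p -> sphere2 R q -> near d (coord p) (coord q) ->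
     lab q <> opp_label (lab p)) ->
  (forall p, sphere2 R p -> lab (- p) = opp_label (lab p)) -> False.
Proof.
move=> d0 near_lab opp_lab.
pose lift (x : bool -> R) : 'rV[R]_3 := \row_i
  (if i == 0 then x true else if i == 1 then x false
   else Num.sqrt (1 - (x true ^+ 2 + x false ^+ 2))).
have liftE x : [/\ coord (lift x) 0 = x true, coord (lift x) 1 = x false
    & coord (lift x) 2%:R = Num.sqrt (1 - (x true ^+ 2 + x false ^+ 2))].
  by rewrite /coord /lift !mxE.
have lift_sphere x : disc x -> sphere2 R (lift x).
  move=> dx; apply/sphere_dot; rewrite dotE; have [-> -> ->] := liftE x.
  by rewrite -!expr2 sqr_sqrtr ?subr_ge0 //; ring.
(* Moving both disc coordinates by at most [e] changes the sum of their squares by at most [4 * e],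
   hence the third coordinate by at most [d]. *)
have [e [e0 ed e4]] : exists e : R, [/\ 0 < e, e <= d & 4 * e <= d ^+ 2].
  exists (Num.min d (d ^+ 2 / 4)).
  have h : 0 < d ^+ 2 / 4 by rewrite divr_gt0 // exprn_gt0.
  split; first by rewrite lt_min d0.
    by rewrite ge_min lexx.
  by rewrite mulrC -ler_pdivlMr // ge_min lexx orbT.
apply: (@discrete_borsuk_ulam_disc R (lab \o lift) e e0) => [x y dx dy xy|x cx] /=.
  apply: near_lab; try exact: lift_sphere.
  have [x1 x2 x3] := liftE x; have [y1 y2 y3] := liftE y.
  have ht := xy true; have hf := xy false.
  have i3 (i : 'I_3) : [\/ i = 0, i = 1 | i = 2%:R].
    by case: i => [[|[|[|//]]] hi]; [apply: Or31|apply: Or32|apply: Or33]; apply: val_inj.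
  move=> i; case: (i3 i) => ->; rewrite ?x1 ?x2 ?x3 ?y1 ?y2 ?y3; try exact: le_trans ed.
  apply: sqrt_dist; rewrite ?subr_ge0 //; first exact: ltW.
  apply: le_trans e4; rewrite ler_norml.
  have bx := disc_unitbox dx; have bY := disc_unitbox dy.
  have := bx true; have := bx false; have := bY true; have := bY false.
  move: ht hf; rewrite !ler_norml => /andP[? ?] /andP[? ?] /andP[? ?] /andP[? ?] /andP[? ?].
  move=> /andP[? ?].
  by apply/andP; split; nra.
have sx : disc x by rewrite /disc cx.
rewrite -opp_lab; last exact: lift_sphere.
congr lab; apply/rowP => i; rewrite !mxE; do 2 case: ifP => // _.
by rewrite /oppf !sqrrN cx subrr sqrtr0 oppr0.
Qed.

End Sphere.

(** * The monodromy of the double cover *)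

(** A minimal non-face inside the triple would have two elements, but all pairs from the triple are
    faces. This is where flagness enters the lower bound. *)
Lemma flag_triangle (T : finType) (K : {set {set T}}) (u v w : T) : flag K ->
  finset.set0 \in K -> (forall v : T, [set v]%SET \in K) ->
  [set u; v]%SET \in K -> [set v; w]%SET \in K -> [set u; w]%SET \in K ->
  [set u; v; w]%SET \in K.
Proof.
move=> fK complex0 complex1 uv vw uw; apply: contraT => nK.
have [s smin sub] := @minset_exists _ (fun t => t \notin K) _ nK.
have /eqP/cards2P[a [b [ab sE]]] := fK s smin.
have /minsetP[+ _] := smin; rewrite sE => abK.
have mem z : z \in s -> [\/ z = u, z = v | z = w].
  by move=> /(fintype.subsetP sub); rewrite !inE -orbA => /or3P[] /eqP->;
     [apply: Or31|apply: Or32|apply: Or33].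
have ha := mem a; have hb := mem b; move: ha hb; rewrite sE !inE !eqxx orbT.
move=> /(_ isT) ha /(_ isT) hb; case/negP: abK.
by case: ha => ->; case: hb => ->; rewrite ?finset.setUid // finset.setUC.
Qed.

Section LowerBound.
Variables (R : realType) (T : finType) (K : {set {set T}}).
Hypothesis K_complex : simplicial_complex K.
Hypothesis K_flag : flag K.
Implicit Types (s : T -> R) (p : 'rV[R]_3) (v w : T).

Definition supp s := [set v | s v != 0]%SET.
Definition pt s := realization_set R K s.

Lemma complex0 : finset.set0 \in K. Proof. by case: K_complex. Qed.
Lemma complex1 v : [set v]%SET \in K. Proof. by case: K_complex. Qed.
Lemma K_down (a b : {set T}) : a \in K -> b \subset a -> b \in K.
Proof. by case: K_complex => _ _; apply. Qed.

Definition star v s := pt s /\ v |: supp s \in K.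
Definition vertex v : T -> R := fun w => (w == v)%:R.

Lemma pt_unitbox s : pt s -> unitbox s.
Proof.
move=> [s0 s1 _] v; rewrite ger0_norm // -s1 (bigD1 v) //= lerDl.
by apply: sumr_ge0.
Qed.

Lemma vertex_pt v : pt (vertex v).
Proof.
split=> [w||]; first by rewrite ler0n.
  by rewrite /vertex (bigD1 v) //= eqxx big1 ?addr0 // => w /negPf->.
apply: K_down (complex1 v) _; apply/fintype.subsetP => w; rewrite !inE /vertex pnatr_eq0.
by case: (w == v).
Qed.

Lemma seg_pt N c s k : pt c -> pt s -> supp c :|: supp s \in K -> (0 < N)%N ->
  (k <= N)%N -> pt (seg N c s k) /\ supp (seg N c s k) \subset supp c :|: supp s.
Proof.
move=> [c0 c1 _] [s0 s1 _] hK N0 kN.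
have sub : supp (seg N c s k) \subset supp c :|: supp s.
  apply/fintype.subsetP => v; rewrite !inE /seg -negb_and; apply: contra => /andP[/eqP-> /eqP->].
  by rewrite subr0 mulr0 addr0.
have N0' : 0 < N%:R :> R by rewrite ltr0n.
have h1 : (k%:R / N%:R : R) <= 1 by rewrite ler_pdivrMr // mul1r ler_nat.
have h0 : 0 <= (k%:R / N%:R : R) by rewrite divr_ge0.
split=> //; split; last exact: K_down hK sub.
  by move=> v; rewrite /seg; have := c0 v; have := s0 v; nra.
rewrite /seg big_split /= -mulr_sumr sumrB c1 s1; lra.
Qed.

(** [t] stands for the projection of the sphere onto |K| and [r] for an arbitrary choice of
    preimages. Continuity of [r] is replaced by [r_unif], which does not see the sign chosen. *)
Variables (t : 'rV[R]_3 -> T -> R) (r : (T -> R) -> 'rV[R]_3).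
Hypothesis t_pt : forall p, sphere2 R p -> pt (t p).
Hypothesis tN : forall p, sphere2 R p -> t (- p) = t p.
Hypothesis r_sphere : forall s, pt s -> sphere2 R (r s).
Hypothesis r_t : forall p, sphere2 R p -> p = r (t p) \/ p = - r (t p).
Hypothesis r_unif : exists2 d, 0 < d &
  forall s s', pt s -> pt s' -> near d s s' -> 1 / 2 < dot (r s) (r s') ^+ 2.
Hypothesis t_unif : forall e, 0 < e -> exists2 d, 0 < d & forall p q,
  sphere2 R p -> sphere2 R q -> near d (coord p) (coord q) -> near e (t p) (t q).

Definition opposite s s' : bool := dot (r s) (r s') < 0.

Section FixedScale.
Variables (d : R) (N : nat).
Hypothesis d0 : 0 < d.
Hypothesis N_large : 4 <= d * N%:R.
Hypothesis r_near :
  forall s s', pt s -> pt s' -> near d s s' -> 1 / 2 < dot (r s) (r s') ^+ 2.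

Lemma opposite_cocycle s s' s'' : pt s -> pt s' -> pt s'' ->
  near d s s' -> near d s' s'' -> near d s s'' ->
  (opposite s s' + opposite s' s'')%R = opposite s s''.
Proof.
by move=> *; apply: gram_sign; auto.
Qed.

(** Parallel transport inside the star of [v]: whether the chosen preimages of [s] and of [v] lie on
    different sheets over that star. *)
Definition monodromy v s : bool := transport opposite N (vertex v) s.

Lemma N0 : (0 < N)%N.
Proof. by have := N_gt0 N_large; rewrite ltr0n. Qed.

Lemma supp_vertex v : supp (vertex v) = [set v]%SET.
Proof. by apply/finset.setP => w; rewrite !inE /vertex pnatr_eq0; case: (w == v). Qed.

Lemma monodromy_near v s s' : star v s -> star v s' -> near (d / 2) s s' ->
  monodromy v s = opposite s s' (+) monodromy v s'.
Proof.
move=> [ps sK] [ps' sK'] ss'.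
have h z : pt z -> v |: supp z \in K -> forall k, (k <= N)%N -> pt (seg N (vertex v) z k).
  move=> pz zK k kN; apply: (proj1 (seg_pt (vertex_pt v) pz _ N0 kN)).
  by rewrite supp_vertex.
apply: (transport_near opposite_cocycle d0 N_large) => //; try exact: h;
  apply: pt_unitbox => //; exact: vertex_pt.
Qed.

Definition edge v w := (v != w) && ([set v; w]%SET \in K).
Definition midpoint v w : T -> R := fun u => (vertex v u + vertex w u) / 2.
Definition holonomy v w s := monodromy v s (+) monodromy w s.
Definition sgn v w := holonomy v w (midpoint v w).

Lemma supp_midpoint v w : supp (midpoint v w) = [set v; w]%SET.
Proof.
apply/finset.setP => u; rewrite !inE /midpoint /vertex mulf_eq0 invr_eq0 pnatr_eq0 orbF -natrD.
by rewrite pnatr_eq0; case: (u == v); case: (u == w).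
Qed.

Lemma midpoint_pt v w : [set v; w]%SET \in K -> pt (midpoint v w).
Proof.
move=> vwK; have [v0 v1 _] := vertex_pt v; have [w0 w1 _] := vertex_pt w.
split; last by rewrite -/(supp _) supp_midpoint.
  by move=> u; rewrite /midpoint; have := v0 u; have := w0 u; lra.
by rewrite /midpoint -mulr_suml big_split /= v1 w1; field.
Qed.

(** The segment from [s] to the midpoint stays in both stars, and each step changes both monodromies
    by the same [opposite], which cancels. *)
Lemma holonomy_const v w s : pt s -> s v != 0 -> s w != 0 -> holonomy v w s = sgn v w.
Proof.
move=> ps sv sw.
have sK : supp s \in K by case: ps.
have sub : [set v; w]%SET \subset supp s.
  by rewrite finset.subUset !finset.sub1set !inE sv sw.
have pm := midpoint_pt (K_down sK sub).
have hK : supp (midpoint v w) :|: supp s \in K.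
  by rewrite supp_midpoint (finset.setUidPr sub).
have st z k : (k <= N)%N -> z \in [set v; w]%SET -> star z (seg N (midpoint v w) s k).
  move=> kN zvw; have [p1 p2] := seg_pt pm ps hK N0 kN; split=> //.
  apply: K_down sK _; rewrite finset.subUset finset.sub1set (fintype.subsetP sub) //=.
  by apply: fintype.subset_trans p2 _; rewrite supp_midpoint (finset.setUidPr sub).
rewrite -(seg0 N (midpoint v w) s) /sgn -[in RHS](segN N_large (midpoint v w) s).
suff : forall k, (k <= N)%N -> holonomy v w (seg N (midpoint v w) s 0) =
   holonomy v w (seg N (midpoint v w) s k) by apply.
elim=> // k IH kN; rewrite IH; last exact: ltnW.
have nn := seg_near_step N_large k (pt_unitbox pm) (pt_unitbox ps).
have v2 : v \in [set v; w]%SET by rewrite !inE eqxx.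
have w2 : w \in [set v; w]%SET by rewrite !inE eqxx orbT.
rewrite /holonomy (monodromy_near (st v _ (ltnW kN) v2) (st v _ kN v2) nn).
rewrite (monodromy_near (st w _ (ltnW kN) w2) (st w _ kN w2) nn).
by rewrite addbACA addbb addFb.
Qed.

Lemma edge_sym : symmetric edge.
Proof. by move=> v w; rewrite /edge eq_sym finset.setUC. Qed.

Lemma sgn_sym : symmetric sgn.
Proof.
move=> v w; rewrite /sgn /holonomy addbC; congr (monodromy _ _ (+) monodromy _ _);
by apply/funext => u; rewrite /midpoint addrC.
Qed.

(** All three signs can be read at the barycentre of the triangle, where each is a sum of two of the
    same three monodromies. *)
Lemma sgn_triangle u v w : edge u v -> edge v w -> edge u w ->
  sgn u v (+) sgn v w = sgn u w.
Proof.
move=> /andP[_ uv] /andP[_ vw] /andP[_ uw].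
have hK := flag_triangle K_flag complex0 complex1 uv vw uw.
pose b z : R := (vertex u z + vertex v z + vertex w z) / 3.
have bE z : (b z != 0) = (z \in [set u; v; w]%SET).
  rewrite /b mulf_eq0 invr_eq0 pnatr_eq0 orbF /vertex -!natrD pnatr_eq0 !inE.
  by case: (z == u); case: (z == v); case: (z == w).
have pb : pt b.
  have [u0 u1 _] := vertex_pt u; have [v0 v1 _] := vertex_pt v; have [w0 w1 _] := vertex_pt w.
  split; first by move=> z; rewrite /b; have := u0 z; have := v0 z; have := w0 z; lra.
    by rewrite /b -mulr_suml !big_split /= u1 v1 w1; field.
  by rewrite (_ : [set v | _]%SET = [set u; v; w]%SET) //; apply/finset.setP => z; rewrite inE bE.
have [bu bv bw] : [/\ b u != 0, b v != 0 & b w != 0] by rewrite !bE !inE !eqxx !orbT.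
rewrite -!(holonomy_const pb) // /holonomy.
by case: (monodromy u b) (monodromy v b) (monodromy w b) => [] [] [].
Qed.

(** A trivialisation of the double cover over the star of [v]: [p] is compared with the chosen
    preimage of [t p], and that one with the chosen preimage of [v]. *)
Definition sheet v p : bool := (p != r (t p)) (+) monodromy v (t p).

Lemma sheetN v p : sphere2 R p -> sheet v (- p) = ~~ sheet v p.
Proof.
move=> sp; rewrite /sheet tN // -addNb; congr (_ (+) _).
have nz := sphere_neqN (r_sphere (t_pt sp)).
by have := r_t sp; move: (r (t p)) nz => x nz [->|->]; rewrite ?opprK nz eqxx.
Qed.

(** Since [dot p q] is positive, [opposite] records exactly whether one of [p] and [q] differs from
    its chosen preimage and the other does not; the monodromies differ by the same bit. *)
Lemma sheet_near v p q : sphere2 R p -> sphere2 R q -> 0 < dot p q ->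
  near (d / 2) (t p) (t q) -> t p v != 0 -> t q v != 0 -> sheet v p = sheet v q.
Proof.
move=> sp sq pq tpq pv qv.
have st z : sphere2 R z -> t z v != 0 -> star v (t z).
  move=> /t_pt tz zv; split=> //; have [_ _ zK] := tz.
  by apply: K_down zK _; rewrite finset.subUset finset.sub1set !inE zv /=.
rewrite /sheet (monodromy_near (st _ sp pv) (st _ sq qv) tpq) addbA; congr (_ (+) _).
have tpq' : near d (t p) (t q).
  by apply: near_le tpq; rewrite {2}(splitr d) lerDl divr_ge0 // ltW.
have := r_near (t_pt sp) (t_pt sq) tpq'; rewrite /opposite.
have np := sphere_neqN (r_sphere (t_pt sp)); have nq := sphere_neqN (r_sphere (t_pt sq)).
have := r_t sp; have := r_t sq; move: (r (t p)) (r (t q)) np nq => x y nx ny hq hp _.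
case: hp hq pq => -> [] ->;
  rewrite ?dotNl ?(dotC x (- y)) ?dotNl ?(dotC y) ?eqxx ?nx ?ny ?opprK => h /=.
- by rewrite lt_gtF.
- by rewrite -oppr_gt0 h.
- by rewrite -oppr_gt0 h.
- by rewrite lt_gtF.
Qed.

End FixedScale.

Lemma big_coordinate s : pt s -> exists v, 1 <= s v * #|T|%:R.
Proof.
move=> [s0 s1 _]; apply: contrapT => /forallNP h.
have lt v : s v * #|T|%:R < 1 by rewrite ltNge; apply/negP; exact: h.
have [v0 _|T0] := pickP (@predT T); last first.
  by move: s1; rewrite big1 => [/eqP|v _]; [rewrite eq_sym oner_eq0|have := T0 v].
have : \sum_v s v * #|T|%:R < \sum_(v : T) 1.
  apply: ltr_sum => //; by apply/hasP; exists v0; rewrite ?mem_index_enum.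
by rewrite -mulr_suml s1 mul1r sumr_const ltxx.
Qed.

Theorem flag_lower_bound : (11 <= #|T|)%N.
Proof.
rewrite leqNgt; apply/negP => T10.
have [d d0 r_near] := r_unif.
have [N N_large] : exists N, 4 <= d * N%:R.
  exists (Num.bound (4 / d)); rewrite mulrC -ler_pdivrMr //.
  by apply: ltW; apply: archi_boundP; rewrite divr_ge0 // ltW.
pose x := sgn N.
have [A [_ [c1 hc1] [c2 hc2]]] : bisplit edge x [set: T]%SET.
  apply: bisplit_small; last by rewrite cardsT.
  - exact: edge_sym.
  - by move=> v; rewrite /edge eqxx.
  - exact: sgn_sym.
  - exact: (sgn_triangle d0 N_large r_near).
pose c v := if v \in A then c1 v else c2 v.
have cP v w : edge v w -> (v \in A) = (w \in A) -> x v w = c v (+) c w.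
  rewrite /c => evw; case: (boolP (w \in A)) => wA vA; rewrite vA.
    by apply: hc1.
  by apply: hc2 => //; rewrite !inE ?vA ?wA.
have [top topP] : exists top : (T -> R) -> T, forall s, pt s -> 1 <= s (top s) * #|T|%:R.
  have [v0 _] := big_coordinate (t_pt (sphere_e0 R)).
  have h s : exists v, pt s -> 1 <= s v * #|T|%:R.
    have [ps|nps] := pselect (pt s); last by exists v0.
    by have [v hv] := big_coordinate ps; exists v.
  by exists (fun s => projT1 (cid (h s))) => s; case: (cid (h s)).
have T0 : (0 < #|T|%:R :> R)%R.
  by rewrite ltr0n; apply/card_gt0P; exists (top 0).
(* Half of the guaranteed coordinate [1 / #|T|], so that the vertex chosen at [t p] keeps a nonzero
   coordinate at a nearby [t q]. *)
have e0 : 0 < 1 / (2 * #|T|%:R) :> R by rewrite divr_gt0 // mulr_gt0.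
have [d1 d10 t_near1] := t_unif e0.
have d20 : 0 < d / 2 by rewrite divr_gt0.
have [d2 d2_0 t_near2] := t_unif d20.
(* If [v] and [w] carry [t p] and lie in the same part, [sheet v p] and [sheet w p] differ by
   [c v (+) c w]. The corrected sheet number therefore depends only on the part, and nearby points
   of one part get equal labels. *)
pose lab p := (top (t p) \in A, c (top (t p)) (+) sheet N (top (t p)) p).
apply: (@discrete_borsuk_ulam R lab (Num.min (Num.min d1 d2) (1 / 2))).
- by rewrite !lt_min d10 d2_0 divr_gt0.
- move=> p q sp sq pq [eA eC].
  have p1 : near d1 (coord p) (coord q) by apply: near_le pq; rewrite !ge_min lexx.
  have p2 : near d2 (coord p) (coord q) by apply: near_le pq; rewrite !ge_min lexx orbT.
  have p3 : 0 < dot p q by apply: dot_near sp sq pq _; rewrite ge_min lexx orbT.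
  have tp := topP _ (t_pt sp); have tq := topP _ (t_pt sq).
  have tt := t_near1 _ _ sp sq p1.
  have nz (y z : R) : 1 <= y * #|T|%:R -> `|y - z| <= 1 / (2 * #|T|%:R) -> z != 0.
    move=> hy hyz; apply: contraTneq hyz => ->; rewrite subr0 -ltNge.
    rewrite ltr_pdivrMr ?mulr_gt0 // mulrCA.
    have := ler_norm y; nra.
  have pp : t p (top (t p)) != 0 by apply: nz tp _; rewrite subrr normr0 ltW.
  have qq : t q (top (t q)) != 0 by apply: nz tq _; rewrite subrr normr0 ltW.
  have qp : t q (top (t p)) != 0 by apply: nz tp (tt _).
  have pq' : t p (top (t q)) != 0 by apply: nz tq _; rewrite distrC; exact: tt.
  have xE := holonomy_const d0 N_large r_near (t_pt sq) qp qq.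
  move: eC; rewrite (sheet_near d0 N_large r_near sp sq p3 (t_near2 _ _ sp sq p2) pp qp).
  rewrite /sheet; move: xE eA; rewrite /holonomy.
  have [<-|ne] := eqVneq (top (t p)) (top (t q)).
    by move=> _ _; case: (c _) (_ != _) (monodromy _ _ _) => [] [] [].
  have ee : edge (top (t p)) (top (t q)).
    rewrite /edge ne /=; have [_ _ qK] := t_pt sq.
    by apply: K_down qK _; rewrite finset.subUset !finset.sub1set !inE qp qq.
  move=> xE eA; rewrite -/x (cP _ _ ee (esym eA)) in xE; move: xE.
  by case: (c _) (c _) (_ != _) (monodromy _ _ _) (monodromy _ _ _) => [] [] [] [] [].
- by move=> p sp; rewrite /lab tN // sheetN // /opp_label /= addbN.
Qed.

End LowerBound.

(** * Compactness and uniform continuity *)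

Lemma compact_set_type (X : topologicalType) (A : set X) :
  compact A -> compact [set: set_type A].
Proof.
move=> cA; have [[a0 _]|/forallNP A0] := pselect (exists a : set_type A, True); last first.
  rewrite (_ : [set: _] = set0); first exact: compact0.
  by rewrite -subset0 => x _; apply: (A0 x).
pose f (x : X) : set_type A := if pselect (A x) is left h then exist _ x (mem_set h) else a0.
have fK (x : set_type A) : f (\val x) = x.
  rewrite /f; case: pselect => [h|]; first exact: val_inj.
  by have := set_mem (valP x).
have -> : [set: set_type A] = f @` A.
  by apply/seteqP; split=> // x _; exists (\val x) => //; exact: set_mem (valP x).
apply: (@continuous_compact _ _ f A _ cA); apply/subspace_sigL_continuousP.
have h : sigL A f =1 idfun by exact: fK.
by rewrite (boolp.funext h) => x; exact: cvg_id.
Qed.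

Lemma continuous_sum (R : realType) (X : topologicalType) (I : Type) (s : seq I)
    (f : I -> X -> R) :
  (forall i, continuous (f i)) -> continuous (fun x => \sum_(i <- s) f i x).
Proof.
move=> hf x; elim: s => [|i s IH].
  under eq_fun do rewrite big_nil; exact: cvg_cst.
by under eq_fun do rewrite big_cons; apply: cvgD => //; exact: hf.
Qed.

(** [delta] is the minimum of [d] on the compact set where [f >= e], positive by hypothesis. *)
Lemma uniform_near_diagonal (R : realType) (X : topologicalType) (d f : X * X -> R) (e : R) :
  compact [set: X] -> continuous d -> continuous f ->
  (forall x y, d (x, y) <= 0 -> f (x, y) < e) ->
  exists2 delta, 0 < delta & forall x y, d (x, y) < delta -> f (x, y) < e.
Proof.
move=> cX cd cf h; pose A := [set z | e <= f z].
have cA : compact A.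
  apply: (@subclosed_compact _ _ ([set: X] `*` [set: X])) => //; last exact: compact_setX.
  apply: (@preimage_closed _ _ f [set y | e <= y]); last exact: closed_ge.
  by move=> z _; exact: cf.
have [A0|/set0P An0] := eqVneq A set0.
  exists 1 => // x y _; rewrite ltNge; apply/negP => fe.
  by have : A (x, y) by []; rewrite A0.
have [z /set_mem Az dz] := compact_EVT_min An0 cA (continuous_subspaceT cd).
exists (d z).
  rewrite ltNge; apply/negP => dz0; move: Az; rewrite /A /= leNgt.
  by case: z dz0 {dz} => x y dz0; rewrite h.
move=> x y dxy; rewrite ltNge; apply/negP => fe.
by have := dz (x, y) (mem_set fe); rewrite leNgt dxy.
Qed.

(** Uniform continuity of [b] relative to [a] with no metric on [X]: sums of absolute differences
    over each family act as the two distances. *)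
Lemma uniform_family (R : realType) (X : topologicalType) (I J : finType)
    (a : I -> X -> R) (b : J -> X -> R) : compact [set: X] ->
  (forall i, continuous (a i)) -> (forall j, continuous (b j)) ->
  (forall x y, a^~ x = a^~ y -> b^~ x = b^~ y) ->
  forall e, 0 < e -> exists2 d, 0 < d &
    forall x y, near d (a^~ x) (a^~ y) -> near e (b^~ x) (b^~ y).
Proof.
move=> cX ca cb ab e e0.
have cdist (L : finType) (c : L -> X -> R) : (forall l, continuous (c l)) ->
    continuous (fun z : X * X => \sum_l `|c l z.1 - c l z.2|).
  move=> cc; apply: continuous_sum => l z; apply: cvg_norm; apply: cvgB.
    by apply: (@continuous_comp _ _ _ fst (c l)); [exact: cvg_fst|exact: cc].
  by apply: (@continuous_comp _ _ _ snd (c l)); [exact: cvg_snd|exact: cc].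
have [|d d0 h] := uniform_near_diagonal (e := e) cX (cdist _ _ ca) (cdist _ _ cb).
  move=> x y /= d0; suff axy : a^~ x = a^~ y.
    by rewrite big1 // => j _; have := congr1 (@^~ j) (ab _ _ axy) => /= ->; rewrite subrr normr0.
  apply: boolp.funext => i; apply/eqP; rewrite -subr_eq0 -normr_eq0 eq_le normr_ge0 andbT.
  by apply: le_trans d0; rewrite (bigD1 i) //= lerDl sumr_ge0.
exists (d / (#|I|%:R + 1)); first by rewrite divr_gt0 // ltr_wpDl.
move=> x y xy j; apply: ltW; apply: le_lt_trans (h x y _).
  by rewrite /= [leRHS](bigD1 j) //= lerDl sumr_ge0.
apply: (@le_lt_trans _ _ (\sum_(i : I) (d / (#|I|%:R + 1)))).
  by apply: ler_sum => i _; exact: xy.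
rewrite sumr_const -[X in X < _]mulr_natl mulrA ltr_pdivrMr ?ltr_wpDl //.
by rewrite mulrC mulrDr mulr1 ltrDl.
Qed.

(** * Compactness, and the Veronese map of the projective plane *)

Section Spaces.
Variable R : realType.

Lemma sphere_compact : compact (sphere2 R).
Proof.
apply: (@subclosed_compact _ _ [set p : 'rV[R]_3 | forall i, `[-1, 1]%classic (p ord0 i)]).
- rewrite /sphere2.
  apply: (@preimage_closed _ _ (fun p : 'rV[R]_3 => \sum_(i < 3) p ord0 i ^+ 2) [set 1]).
    move=> p _; apply: continuous_sum => i q; apply: continuousM; exact: coord_continuous.
  exact: closed_eq.
- exact: (@rV_compact R 3 (fun=> `[-1, 1]%classic) (fun=> @segment_compact R (-1) 1)).
- move=> p /sphere_dot sp i; have := sp; rewrite /dot (bigD1 i) //= in_itv /= -/(coord p i) => h.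
  have : 0 <= \sum_(j < 3 | j != i) coord p j * coord p j by apply: sumr_ge0 => j _; exact: sqr_ge0.
  by move: h; move: (\sum_(_ < _ | _) _) => z h z0; apply/andP; split; nra.
Qed.

Lemma realization_compact (T : finType) (K : {set {set T}}) :
  simplicial_complex K -> compact (realization_set R K).
Proof.
move=> [_ _ Kdown].
apply: (@subclosed_compact _ _ [set x : {ptws T -> R} | forall v, `[0, 1]%classic (x v)]).
(* The support condition is not visibly closed, so the realization is rewritten as a finite union of
   closed simplices. *)
- pose F (s : {set T}) := [set x : {ptws T -> R} | \sum_v x v = 1] `&`
     [set x : {ptws T -> R} | forall v, 0 <= x v /\ (v \notin s -> x v = 0)].
  have -> : realization_set R K = \bigcup_(s in [set` K]) F s.
    apply/seteqP; split=> x.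
      move=> [x0 x1 xK]; exists [set v | x v != 0]%SET => //; split=> // v; split=> //.
      by rewrite inE negbK => /eqP.
    move=> [s /= sK [x1 xs]]; split=> // [v|]; first by case: (xs v).
    apply: Kdown sK _; apply/fintype.subsetP => v; rewrite inE.
    by apply: contraNT => /(proj2 (xs v)) ->.
  apply: closed_bigcup => [|s _]; first exact: finite_finset.
  apply: closedI.
    apply: (@preimage_closed _ _ (fun p : {ptws T -> R} => \sum_v p v) [set 1]).
      move=> p _; apply: continuous_sum => v; exact: proj_continuous.
    exact: closed_eq.
  rewrite (_ : [set x | _] = \bigcap_(v in [set: T])
    [set x : {ptws T -> R} | 0 <= x v /\ (v \notin s -> x v = 0)]); last first.
    by apply/seteqP; split=> x h v => [_|]; [exact: h|exact: (h v I)].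
  apply: closed_bigI => v _.
  apply: (@preimage_closed _ _ (fun p : {ptws T -> R} => p v)
    [set y | 0 <= y /\ (v \notin s -> y = 0)]).
    move=> p _; exact: proj_continuous.
  rewrite (_ : [set y | _] = [set y : R | 0 <= y] `&` (if v \in s then setT else [set 0])).
    by apply: closedI; [exact: closed_ge|case: ifP => _; [exact: closedT|exact: closed_eq]].
  rewrite predeqE => y; rewrite /setI /=; case: (v \in s) => /=; split=> -[h1 h2]; split=> //.
  by apply: h2.
- exact: (@tychonoff T (fun=> R) (fun=> `[0, 1]%classic) (fun=> @segment_compact R 0 1)).
- move=> x px v; rewrite /= in_itv /=; case: (px) => x0 _ _.
  by rewrite x0 (le_trans (ler_norm _)) // (pt_unitbox px).
Qed.


Lemma coord_sphere_continuous (i : 'I_3) :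
  continuous (fun x : set_type (sphere2 R) => coord (\val x) i).
Proof.
move=> x; apply: (@continuous_comp (set_type (sphere2 R)) 'rV[R]_3 R set_val (fun p => coord p i)).
  exact: initial_continuous.
exact: coord_continuous.
Qed.

Lemma coordinate_continuous (T : finType) (K : {set {set T}}) (v : T) :
  continuous (fun s : realization R K => (\val s : T -> R) v).
Proof.
move=> x; apply: (@continuous_comp (realization R K) {ptws T -> R} R set_val (fun p => p v)).
  exact: initial_continuous.
exact: proj_continuous.
Qed.

Notation S2 := (set_type (sphere2 R)).

Definition proj (x : S2) : RP2 R :=
  \pi_(quotient_topology {eq_quot (antipodal_equiv R)}) x.
Definition section (y : RP2 R) : S2 :=
  repr (y : quotient_topology {eq_quot (antipodal_equiv R)}).

Lemma sectionK : cancel section proj.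
Proof. exact: reprK. Qed.

Lemma proj_eq (x y : S2) : proj x = proj y <-> \val x = \val y \/ \val x = - \val y.
Proof.
split=> [/eqmodP|h].
  by rewrite /= /antipodal => /orP[] /eqP; [left|right].
by apply/eqmodP; rewrite /= /antipodal; case: h => ->; rewrite eqxx ?orbT.
Qed.

Lemma section_proj (x : S2) :
  \val x = \val (section (proj x)) \/ \val x = - \val (section (proj x)).
Proof. by apply/proj_eq; rewrite sectionK. Qed.

Definition veronese (ij : 'I_3 * 'I_3) (y : RP2 R) : R :=
  coord (\val (section y)) ij.1 * coord (\val (section y)) ij.2.

Lemma veronese_proj ij (x : S2) :
  veronese ij (proj x) = coord (\val x) ij.1 * coord (\val x) ij.2.
Proof.
rewrite /veronese; case: (section_proj x) => ->//.
by rewrite /coord !mxE mulrNN.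
Qed.

Lemma veronese_continuous ij : continuous (veronese ij).
Proof.
apply/quotient_continuous => x.
rewrite (_ : _ \o _ = fun x : S2 => coord (\val x) ij.1 * coord (\val x) ij.2).
  by apply: continuousM; exact: coord_sphere_continuous.
by apply: boolp.funext => z; exact: veronese_proj.
Qed.

(** The Veronese map sends a line to its projection matrix. Closeness of two lines thus becomes a
    squared inner product near 1, whatever preimages are chosen. *)
Lemma veronese_dot y y' :
  \sum_ij (veronese ij y * veronese ij y') = dot (\val (section y)) (\val (section y')) ^+ 2.
Proof.
rewrite expr2 /dot big_distrlr /= pair_bigA /=; apply: eq_bigr => ij _.
by rewrite /veronese; ring.
Qed.

End Spaces.

Theorem RP2_flag_lower (R : realType) (T : finType) (K : {set {set T}}) :
  RP2_triangulation R K -> flag K -> (11 <= #|T|)%N.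
Proof.
move=> [cK [F [G [cF cG FG GF]]]] fK.
pose ptS p (h : sphere2 R p) : set_type (sphere2 R) := exist _ p (mem_set h).
pose ptK s (h : realization_set R K s) : realization R K := exist _ s (mem_set h).
pose t p : T -> R :=
  if pselect (sphere2 R p) is left h then \val (G (proj (ptS p h))) else fun=> 0.
pose r s : 'rV[R]_3 :=
  if pselect (realization_set R K s) is left h then \val (section (F (ptK s h))) else 0.
have tE (x : set_type (sphere2 R)) : t (\val x) = \val (G (proj x)).
  rewrite /t; case: pselect => [h|]; first by congr (\val (G (proj _))); apply: val_inj.
  by have := set_mem (valP x).
have rE (x : set_type (realization_set R K)) : r (\val x) = \val (section (F x)).
  rewrite /r; case: pselect => [h|]; first by congr (\val (section (F _))); apply: val_inj.
  by have := set_mem (valP x).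
have S2 p : sphere2 R p -> exists x : set_type (sphere2 R), p = \val x.
  by move=> h; exists (ptS p h).
have KP s : pt (R := R) K s -> exists x : set_type (realization_set R K), s = \val x.
  by move=> h; exists (ptK s h).
apply: (@flag_lower_bound R T K cK fK t r).
- by move=> p /S2[x ->]; rewrite tE; exact: set_mem (valP _).
- move=> p sp; have /S2[y hy] := sphereN sp; move: sp hy => /S2[x ->] hy.
  by rewrite hy !tE; congr (\val (G _)); apply/proj_eq; right.
- by move=> s /KP[x ->]; rewrite rE; exact: set_mem (valP _).
- by move=> p /S2[x ->]; rewrite tE rE GF; exact: section_proj.
- have cX : compact [set: realization R K] by exact/compact_set_type/realization_compact.
  have cM ij : continuous (veronese ij \o F).
    by move=> s; apply: continuous_comp; [exact: cF|exact: veronese_continuous].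
  (* Nine coordinates within 1/4 give [2 - 2 * dot ^ 2 <= 9 / 16], hence [dot ^ 2 > 1 / 2]. *)
  have e0 : 0 < 1 / 4 :> R by rewrite divr_gt0.
  have [x y xy|d d0 h] := uniform_family cX (@coordinate_continuous R T K) cM _ e0.
    by have -> : x = y by apply: val_inj.
  exists d => // s s' /KP[x ->] /KP[y ->] /h {}h; rewrite !rE -veronese_dot.
  have hh ij : (veronese ij (F x) - veronese ij (F y)) ^+ 2 <= 1 / 16.
    by have /= := h ij; rewrite ler_norml => /andP[h1 h2]; nra.
  have sx (z : set_type (sphere2 R)) : dot (\val z) (\val z) = 1.
    by apply/sphere_dot; exact: set_mem (valP z).
  have vx := veronese_dot (F x) (F x); have vy := veronese_dot (F y) (F y).
  rewrite !sx expr1n in vx vy.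
  have : \sum_ij (veronese ij (F x) - veronese ij (F y)) ^+ 2 <= \sum_(ij : 'I_3 * 'I_3) 1 / 16.
    by apply: ler_sum => ij _; exact: hh.
  rewrite sumr_const card_prod card_ord.
  rewrite (eq_bigr (fun ij => veronese ij (F x) * veronese ij (F x)
    + veronese ij (F y) * veronese ij (F y) - 2 * (veronese ij (F x) * veronese ij (F y))));
    last by move=> ij _; ring.
  rewrite sumrB big_split /= vx vy -mulr_sumr => {}h; lra.
- move=> e e0.
  have cX : compact [set: set_type (sphere2 R)] by exact/compact_set_type/sphere_compact.
  have cM v : continuous ((fun s : realization R K => (\val s : T -> R) v) \o (G \o @proj R)).
    move=> x; apply: continuous_comp; last exact: coordinate_continuous.
    by apply: continuous_comp; [exact: pi_continuous|exact: cG].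
  have [x y xy|d d0 h] := uniform_family cX (@coord_sphere_continuous R) cM _ e0.
    have -> // : x = y.
    by apply: val_inj; apply/rowP => i; have := congr1 (@^~ i) xy.
  by exists d => // p q /S2[x ->] /S2[y ->] /h; rewrite !tE.
Qed.

(** * A centrally symmetric polytope with 22 vertices *)

(* The 22 points +-[coords] are the vertices of a convex polytope, found by a random
   search.  Each of its 20 antipodal pairs of facets is listed once, as a positively
   oriented triple of signed vertices (index, sign). *)
Definition coords : seq (seq int) :=
  [:: [:: 1; 4; 2];
   [:: -3; -2; 2];
   [:: -1; 2; -3];
   [:: -2; -4; 1];
   [:: -3; -1; -4];
   [:: 3; -2; -1];
   [:: -3; 1; -1];
   [:: -1; 4; 1];
   [:: -2; 1; 3];
   [:: -4; -3; -3];
   [:: -1; 3; -2]].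

Definition facets : seq (seq (nat * int)) :=
  [:: [:: (0%N, 1); (3%N, -1); (7%N, 1)];
   [:: (0%N, 1); (9%N, -1); (3%N, -1)];
   [:: (0%N, 1); (8%N, 1); (4%N, -1)];
   [:: (0%N, 1); (4%N, -1); (9%N, -1)];
   [:: (0%N, 1); (7%N, 1); (8%N, 1)];
   [:: (1%N, 1); (3%N, 1); (2%N, -1)];
   [:: (1%N, 1); (2%N, -1); (8%N, 1)];
   [:: (1%N, 1); (9%N, 1); (3%N, 1)];
   [:: (1%N, 1); (8%N, 1); (5%N, -1)];
   [:: (1%N, 1); (5%N, -1); (9%N, 1)];
   [:: (2%N, 1); (10%N, 1); (3%N, -1)];
   [:: (2%N, 1); (8%N, -1); (4%N, 1)];
   [:: (2%N, 1); (4%N, 1); (10%N, 1)];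
   [:: (3%N, 1); (7%N, -1); (10%N, -1)];
   [:: (4%N, 1); (9%N, 1); (6%N, 1)];
   [:: (4%N, 1); (6%N, 1); (10%N, 1)];
   [:: (5%N, 1); (9%N, -1); (6%N, -1)];
   [:: (5%N, 1); (6%N, -1); (10%N, -1)];
   [:: (5%N, 1); (7%N, -1); (8%N, -1)];
   [:: (5%N, 1); (10%N, -1); (7%N, -1)]].

Section Vectors.
Variable A : comRingType.
Implicit Types a b : nat -> A.
Definition dot3 a b := a 0%N * b 0%N + a 1%N * b 1%N + a 2%N * b 2%N.
Definition cross a b (i : nat) : A :=
  a ((i + 1) %% 3)%N * b ((i + 2) %% 3)%N - a ((i + 2) %% 3)%N * b ((i + 1) %% 3)%N.
End Vectors.

Definition vertex_coord (v i : nat) : int := nth 0 (nth [::] coords v) i.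
Definition fvert (f : seq (nat * int)) k := (nth (0%N, 0) f k).1.
Definition fsign (f : seq (nat * int)) k := (nth (0%N, 0) f k).2.
Definition fvec f k i : int := fsign f k * vertex_coord (fvert f k) i.
(* [fnormal f k / fdet f] is the k-th coordinate form in the basis of the signed
   vertices of [f], and the sum [fform f / fdet f] of the three forms is 1 on [f]. *)
Definition fnormal f k : nat -> int := cross (fvec f ((k + 1) %% 3)) (fvec f ((k + 2) %% 3)).
Definition fdet f : int := dot3 (fnormal f 0) (fvec f 0).
Definition fform f i : int := fnormal f 0 i + fnormal f 1 i + fnormal f 2 i.
Definition verts (f : seq (nat * int)) : seq nat := map fst f.
Definition vsign (f : seq (nat * int)) v := fsign f (index v (verts f)).
Definition face s f := all (mem (verts f)) s.
(** The sign is read off the first facet containing both vertices, and [check_sign] makes it the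
    same in all of them. Without such a facet the default values give 0. *)
Definition xz v w : int :=
  let f := nth [::] facets (find (face [:: v; w]) facets) in vsign f v * vsign f w.

Definition check_facet f :=
  [&& size f == 3%N, uniq (verts f), all (fun v => v < 11)%N (verts f), 0 < fdet f
    & all (fun a => `|a.2| == 1) f].
(** Together with [check_dual']: normals and vertices are inverse matrices up to [fdet f], checked
    in both orders because one gives the coordinates of the vertices and the other the expansion of
    an arbitrary vector. *)
Definition check_dual f :=
  all (fun k => all (fun j => dot3 (fnormal f k) (fvec f j) == (if j == k then fdet f else 0))
     (iota 0 3)) (iota 0 3).
Definition check_dual' f :=
  all (fun i => all (fun j => fnormal f 0 i * fvec f 0 j + fnormal f 1 i * fvec f 1 j
    + fnormal f 2 i * fvec f 2 j == (if i == j then fdet f else 0)) (iota 0 3)) (iota 0 3).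
(* Together with central symmetry: every facet plane supports the polytope. *)
Definition check_convex f :=
  all (fun v => (v \in verts f) || (`|dot3 (fform f) (vertex_coord v)| < fdet f)) (iota 0 11).
(** Up to the antipodal sign [e], [g] is the facet across the edge opposite to vertex [k]: its plane
    contains the other two vertices. *)
Definition check_neighbour f :=
  all (fun k => has (fun g => (fvert f k \notin verts g) &&
    has (fun e : int => all (fun j => (j == k) || (e * dot3 (fform g) (fvec f j) == fdet g))
      (iota 0 3)) [:: 1; -1]) facets) (iota 0 3).
Definition check_sign f :=
  all (fun j => all (fun k => xz (fvert f j) (fvert f k) == fsign f j * fsign f k)
    (iota 0 3)) (iota 0 3).
Definition adj v w := has (face [:: v; w]) facets.
(** Every 3-clique is a face, and no 4-clique exists. *)
Definition check_flag :=
  all (fun a => has (face [:: a]) facets && all (fun b => adj a b ==> all (fun c =>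
    [&& a != b, b != c, a != c, adj a c & adj b c] ==> has (face [:: a; b; c]) facets &&
     all (fun d => [&& d != a, d != b, d != c, adj a d & adj b d] ==> ~~ adj c d) (iota 0 11))
     (iota 0 11)) (iota 0 11)) (iota 0 11).

Lemma facetsP : all (fun f => [&& check_facet f, check_dual f, check_dual' f, check_convex f,
  check_neighbour f & check_sign f]) facets.
Proof. by vm_compute. Qed.

Lemma flagP : check_flag.
Proof. by vm_compute. Qed.

Definition rp2_11 : {set {set 'I_11}} :=
  [set s : {set 'I_11} | has (fun f => [forall v in s, (v : nat) \in verts f]) facets]%SET.

Lemma rp2_11P (s : {set 'I_11}) :
  reflect (exists2 f, f \in facets & forall v, v \in s -> (v : nat) \in verts f) (s \in rp2_11).
Proof.
rewrite inE; apply: (iffP hasP) => -[f fF h]; exists f => //.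
  by move=> v; exact: (forall_inP h).
exact/forall_inP.
Qed.

Lemma face_rp2_11 (s : seq 'I_11) : has (face (map val s)) facets -> [set:: s]%SET \in rp2_11.
Proof.
move=> /hasP[f fF /allP h]; apply/rp2_11P; exists f => // v; rewrite inE => vs.
by apply: h; exact: map_f.
Qed.

Lemma rp2_11_adj (v w : 'I_11) : ([set v; w]%SET \in rp2_11) -> adj v w.
Proof.
move=> /rp2_11P[f fF h]; apply/hasP; exists f => //.
by rewrite /face /= !h ?inE ?eqxx ?orbT.
Qed.

Lemma rp2_11_complex : simplicial_complex rp2_11.
Proof.
split.
- by apply/rp2_11P; exists (nth [::] facets 0) => [|v]; rewrite ?mem_nth ?inE.
- move=> v; have it : (v : nat) \in iota 0 11 by rewrite mem_iota ltn_ord.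
  have /andP[h _] := allP flagP v it.
  by have := @face_rp2_11 [:: v] h; congr (_ \in rp2_11); apply/finset.setP => w; rewrite !inE.
- move=> s t /rp2_11P[f fF h] /fintype.subsetP ts; apply/rp2_11P; exists f => // v /ts; exact: h.
Qed.

(** A minimal non-face with at least three vertices would be a clique, hence either a triple, which
    is a face, or a set containing a 4-clique. *)
Lemma rp2_11_flag : flag rp2_11.
Proof.
move=> s /minsetP[nsK smin].
have prop (t : {set 'I_11}) : t \subset s -> t != s -> t \in rp2_11.
  by move=> ts; apply: contraNT => tK; apply/eqP; apply: smin.
have [K0 K1 Kdown] := rp2_11_complex.
have [s1|s2] := leqP #|s| 1.
  case/negP: nsK; move: s1; rewrite leq_eqVlt ltnS leqn0 => /orP[/cards1P[v ->]//|].
  by rewrite cards_eq0 => /eqP ->.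
apply/eqP; rewrite eqn_leq s2 andbT leqNgt; apply/negP => s3.
have sadj (v w : 'I_11) : v \in s -> w \in s -> adj v w.
  move=> vs ws; apply: rp2_11_adj; apply: prop.
    by rewrite finset.subUset !finset.sub1set vs ws.
  by apply: contraTneq s3 => <-; rewrite cards2; case: eqP.
have [a [b [c [[aS bS cS] [ab bc ca]]]]] := card_gt2P s3.
have it (v : 'I_11) : (v : nat) \in iota 0 11 by rewrite mem_iota ltn_ord.
have /andP[_ /allP hb] := allP flagP a (it a).
have /implyP hb1 := hb b (it b); have /allP hc := hb1 (sadj _ _ aS bS).
have := implyP (hc c (it c)).
rewrite -val_eqE -(val_eqE c) in ab ca; rewrite -val_eqE in bc.
rewrite ab bc eq_sym ca !sadj // => /(_ isT)/andP[abc /allP h].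
have [sE|nE] := eqVneq [set a; b; c]%SET s.
  case/negP: nsK; rewrite -sE; have := @face_rp2_11 [:: a; b; c] abc.
  by congr (_ \in rp2_11); apply/finset.setP => w; rewrite !inE orbA.
have sub : [set a; b; c]%SET \subset s by rewrite !finset.subUset !finset.sub1set aS bS cS.
have : [set a; b; c]%SET \proper s by rewrite finset.properEneq nE.
move=> /properP[_ [d dS]]; rewrite !inE !negb_or -!val_eqE => /andP[/andP[da db] dc].
by have /implyP := h d (it d); rewrite da db dc !sadj // => /(_ isT).
Qed.

(** * The realization of the polytope quotient *)

(** [a] is a closed map, from a compact to a Hausdorff space, and [h] is [b] followed by the inverse
    of [a]. *)
Lemma compact_lift_continuous (X Y Z : topologicalType) (a : X -> Z) (b : Y -> Z)
    (h : Y -> X) : compact [set: X] -> hausdorff_space Z ->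
  continuous a -> injective a -> continuous b -> (forall y, a (h y) = b y) ->
  continuous h.
Proof.
move=> cX hZ ca ia cb ah; apply/continuous_closedP => C cC.
have -> : h @^-1` C = b @^-1` (a @` C).
  apply/seteqP; split=> y /= => [hC|[x Cx axb]]; first by exists (h y).
  by rewrite (_ : h y = x) //; apply: ia; rewrite ah.
apply: preimage_closed => [y _|]; first exact: cb.
apply: compact_closed => //; apply: continuous_compact; first exact: continuous_subspaceT.
exact: (@subclosed_compact _ _ [set: X]).
Qed.

Lemma continuous_ptws (R : realType) (I : eqType) (X : topologicalType) (a : X -> {ptws I -> R}) :
  (forall i, continuous (fun x => a x i)) -> continuous a.
Proof.
move=> ca x; apply/cvg_sup => i U [_ [[B oB <-] Bx] sU].
have nB : nbhs (a x i) B by apply: open_nbhs_nbhs.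
by apply: (@filterS _ (nbhs x) _ _ _ _ (ca i x B nB)) => z Bz; exact: sU.
Qed.

Lemma homeomorphic_images (R : realType) (I : finType) (X Y : topologicalType)
    (a : I -> X -> R) (b : I -> Y -> R) : compact [set: X] -> compact [set: Y] ->
  (forall i, continuous (a i)) -> (forall i, continuous (b i)) ->
  (forall x x', (forall i, a i x = a i x') -> x = x') ->
  (forall y y', (forall i, b i y = b i y') -> y = y') ->
  (forall x, exists y, forall i, b i y = a i x) ->
  (forall y, exists x, forall i, a i x = b i y) -> homeomorphic X Y.
Proof.
move=> cX cY ca cb ia ib ab ba.
have [f fP] : exists f : X -> Y, forall x i, b i (f x) = a i x.
  by exists (fun x => projT1 (cid (ab x))) => x; case: (cid (ab x)).
have [g gP] : exists g : Y -> X, forall y i, a i (g y) = b i y.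
  by exists (fun x => projT1 (cid (ba x))) => x; case: (cid (ba x)).
pose Z : topologicalType := {ptws I -> R}.
have hZ : hausdorff_space Z by apply: hausdorff_product => i; exact: Rhausdorff.
pose A x : Z := fun i => a i x; pose B y : Z := fun i => b i y.
have cA : continuous A by apply: continuous_ptws => i; exact: ca.
have cB : continuous B by apply: continuous_ptws => i; exact: cb.
have iA : injective A by move=> x x' e; apply: ia => i; exact: (congr1 (@^~ i) e).
have iB : injective B by move=> x x' e; apply: ib => i; exact: (congr1 (@^~ i) e).
have Bf x : B (f x) = A x by apply: boolp.funext => i; exact: fP.
have Ag y : A (g y) = B y by apply: boolp.funext => i; exact: gP.
exists f, g; split.
- exact: (compact_lift_continuous cY hZ cB iB cA Bf).
- exact: (compact_lift_continuous cX hZ cA iA cB Ag).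
- by move=> x; apply: iA; rewrite Ag Bf.
- by move=> y; apply: iB; rewrite Bf Ag.
Qed.

Section Polytope.
Variable R : realType.
Implicit Types (p n : nat -> R) (s : 'I_11 -> R) (f : seq (nat * int)) (k : nat).

Definition toR (a : nat -> int) : nat -> R := fun i => (a i)%:~R.

Lemma dot3_toR (a b : nat -> int) : dot3 (toR a) (toR b) = (dot3 a b)%:~R.
Proof. by rewrite /dot3 !intrD !intrM. Qed.

Definition polyvertex v := toR (vertex_coord v).
Definition facetvertex f k := toR (fvec f k).
Definition facetdet f : R := (fdet f)%:~R.
Definition alpha f k p : R := dot3 (toR (fnormal f k)) p / facetdet f.
Definition idx f k : 'I_11 := inord (fvert f k).
Definition point f s : nat -> R :=
  fun i => s (idx f 0) * facetvertex f 0 i + s (idx f 1) * facetvertex f 1 i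
    + s (idx f 2) * facetvertex f 2 i.
Definition supported f s := forall v : 'I_11, (v : nat) \notin verts f -> s v = 0.
(* If s is supported on a facet and u is the corresponding point of that facet, this
   is u_i u_j, which is insensitive to the sign of u. *)
Definition moment s (i j : nat) : R :=
  \sum_v \sum_w s v * s w * (xz v w)%:~R * polyvertex v i * polyvertex w j.
Definition quad n s : R := dot3 n (fun i => dot3 n (moment s i)).
Definition trace s : R := moment s 0 0 + moment s 1 1 + moment s 2 2.

Section Facet.
Variable f : seq (nat * int).
Hypothesis fF : f \in facets.

Let checks := allP facetsP f fF.

Lemma facetdet_gt0 : 0 < facetdet f.
Proof. by have /andP[/and5P[_ _ _ h _] _] := checks; rewrite /facetdet ltr0z. Qed.

Lemma facet_verts : [/\ size f = 3%N, uniq (verts f) & {in verts f, forall v, (v < 11)%N}].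
Proof. by have /andP[/and5P[/eqP h1 h2 /allP h3 _ _] _] := checks. Qed.

Lemma verts_fvert : verts f = [:: fvert f 0; fvert f 1; fvert f 2].
Proof.
have [sz _ _] := facet_verts; rewrite /verts /fvert.
by case: f sz => [|a [|b [|c [|]]]].
Qed.

Lemma iota3 k : (k < 3)%N -> k \in iota 0 3. Proof. by rewrite mem_iota. Qed.

Lemma fvert_mem k : (k < 3)%N -> fvert f k \in verts f.
Proof. by rewrite verts_fvert; case: k => [|[|[|//]]] _; rewrite !inE eqxx ?orbT. Qed.

Lemma idx_val k : (k < 3)%N -> idx f k = fvert f k :> nat.
Proof. by move=> k3; have [_ _ h] := facet_verts; rewrite inordK // h // fvert_mem. Qed.

Lemma dual k j : (k < 3)%N -> (j < 3)%N ->
  dot3 (toR (fnormal f k)) (facetvertex f j) = if j == k then facetdet f else 0.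
Proof.
have /and3P[_ /allP h _] := checks => /iota3/h/allP {}h /iota3/h/eqP e.
by rewrite dot3_toR e; case: eqP.
Qed.

Lemma expand p i : (i < 3)%N ->
  p i = alpha f 0 p * facetvertex f 0 i + alpha f 1 p * facetvertex f 1 i
    + alpha f 2 p * facetvertex f 2 i.
Proof.
have /and4P[_ _ /allP h _] := checks => i3.
have e j : (j < 3)%N ->
    toR (fnormal f 0) j * facetvertex f 0 i + toR (fnormal f 1) j * facetvertex f 1 i
    + toR (fnormal f 2) j * facetvertex f 2 i = if j == i then facetdet f else 0.
  move=> /iota3/h/allP /(_ i (iota3 i3)) /eqP e.
  by rewrite /facetvertex /toR -!intrM -!intrD e; case: eqP.
have d0 : facetdet f != 0 by rewrite gt_eqF // facetdet_gt0.
apply: (mulIf d0); rewrite /alpha.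
rewrite [RHS](_ : _ = (toR (fnormal f 0) 0%N * facetvertex f 0 i
    + toR (fnormal f 1) 0%N * facetvertex f 1 i
    + toR (fnormal f 2) 0%N * facetvertex f 2 i) * p 0%N
  + (toR (fnormal f 0) 1%N * facetvertex f 0 i + toR (fnormal f 1) 1%N * facetvertex f 1 i
    + toR (fnormal f 2) 1%N * facetvertex f 2 i) * p 1%N
  + (toR (fnormal f 0) 2%N * facetvertex f 0 i + toR (fnormal f 1) 2%N * facetvertex f 1 i
    + toR (fnormal f 2) 2%N * facetvertex f 2 i) * p 2%N); last first.
  by rewrite /dot3; field.
rewrite !e //; case: i i3 {e} => [|[|[|//]]] _ /=; ring.
Qed.

Lemma dot3_expand n p : dot3 n p = alpha f 0 p * dot3 n (facetvertex f 0)
  + alpha f 1 p * dot3 n (facetvertex f 1) + alpha f 2 p * dot3 n (facetvertex f 2).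
Proof. by rewrite {1}/dot3 !(@expand p) // /dot3; ring. Qed.

Lemma dot3_point n s : dot3 n (point f s) = s (idx f 0) * dot3 n (facetvertex f 0)
  + s (idx f 1) * dot3 n (facetvertex f 1) + s (idx f 2) * dot3 n (facetvertex f 2).
Proof. by rewrite /dot3 /point; ring. Qed.

Lemma normal_point k s : (k < 3)%N ->
  dot3 (toR (fnormal f k)) (point f s) = s (idx f k) * facetdet f.
Proof.
by move=> k3; rewrite dot3_point !dual //; case: k k3 => [|[|[|//]]] _ /=; ring.
Qed.

Lemma sum_supported s (g : 'I_11 -> R) : supported f s ->
  \sum_v s v * g v = s (idx f 0) * g (idx f 0) + s (idx f 1) * g (idx f 1)
    + s (idx f 2) * g (idx f 2).
Proof.
move=> sf; have [_ uf _] := facet_verts.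
pose r := [:: idx f 0; idx f 1; idx f 2].
have mr : map val r = verts f by rewrite verts_fvert /= !idx_val.
have ur : uniq r by rewrite -(map_inj_uniq val_inj) mr.
rewrite (bigID (mem r)) /= [X in _ + X]big1 ?addr0 => [|v vr].
  by rewrite -big_uniq //= /r !big_cons big_nil addr0 addrA.
by rewrite sf ?mul0r // -mr (mem_map val_inj).
Qed.

Lemma facetvertexE k i : facetvertex f k i = (fsign f k)%:~R * polyvertex (fvert f k) i.
Proof. by rewrite /facetvertex /toR /fvec intrM. Qed.

Lemma moment_facet s i j : supported f s -> moment s i j = point f s i * point f s j.
Proof.
move=> sf; rewrite /moment.
rewrite (eq_bigr (fun v =>
  s v * \sum_w s w * ((xz v w)%:~R * polyvertex v i * polyvertex w j))); last first.
  by move=> v _; rewrite mulr_sumr; apply: eq_bigr => w _; ring.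
rewrite (sum_supported _ sf) !(sum_supported _ sf) !idx_val //.
have /and5P[_ _ _ _ /andP[_ /allP h]] := checks.
have e a b : (a < 3)%N -> (b < 3)%N ->
    xz (fvert f a) (fvert f b) = fsign f a * fsign f b.
  by move=> /iota3/h/allP {}h /iota3/h/eqP.
rewrite !e // !intrM /point !facetvertexE.
move: (s _) (s _) (s _) ((fsign f 0)%:~R : R) ((fsign f 1)%:~R : R) ((fsign f 2)%:~R : R).
move: (polyvertex (fvert f 0) i) (polyvertex (fvert f 1) i) (polyvertex (fvert f 2) i).
move: (polyvertex (fvert f 0) j) (polyvertex (fvert f 1) j) (polyvertex (fvert f 2) j) => *; ring.
Qed.

Lemma quad_facet n s : supported f s -> quad n s = dot3 n (point f s) ^+ 2.
Proof. by move=> sf; rewrite /quad /dot3 !moment_facet //; ring. Qed.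

Lemma trace_facet s : supported f s -> trace s = dot3 (point f s) (point f s).
Proof. by move=> sf; rewrite /trace /dot3 !moment_facet. Qed.

Lemma form_vertex (v : nat) : (v < 11)%N -> v \notin verts f ->
  `|dot3 (toR (fform f)) (polyvertex v)| < facetdet f.
Proof.
have /and5P[_ _ _ /allP h _] := checks.
move=> v11 /negPf vf; have := h v; rewrite mem_iota /= vf v11 => /(_ isT) /= lt.
by rewrite dot3_toR -intr_norm /facetdet ltr_int.
Qed.

Lemma form_sum p : dot3 (toR (fform f)) p =
  (alpha f 0 p + alpha f 1 p + alpha f 2 p) * facetdet f.
Proof.
have d0 : facetdet f != 0 by rewrite gt_eqF // facetdet_gt0.
rewrite /alpha -!mulrDl divfK // /dot3 /toR /fform !intrD; ring.
Qed.

Lemma fsign_norm k : (k < 3)%N -> `|(fsign f k)%:~R| = 1 :> R.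
Proof.
have /andP[/and5P[/eqP sz _ _ _ /allP h] _] := checks.
by move=> k3; have := h (nth (0%N, 0) f k); rewrite mem_nth ?sz // => /(_ isT)/eqP e;
  rewrite -intr_norm e.
Qed.

Lemma dot3_facetvertex n k : (k < 3)%N ->
  `|dot3 n (facetvertex f k)| = `|dot3 n (polyvertex (fvert f k))|.
Proof.
move=> k3; rewrite (_ : dot3 n (facetvertex f k) =
  (fsign f k)%:~R * dot3 n (polyvertex (fvert f k))).
  by rewrite normrM fsign_norm // mul1r.
by rewrite /dot3 !facetvertexE; ring.
Qed.

Lemma form_facetvertex k : (k < 3)%N -> dot3 (toR (fform f)) (facetvertex f k) = facetdet f.
Proof.
move=> k3; rewrite (_ : dot3 _ _ = dot3 (toR (fnormal f 0)) (facetvertex f k)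
  + dot3 (toR (fnormal f 1)) (facetvertex f k) + dot3 (toR (fnormal f 2)) (facetvertex f k)).
  by rewrite !dual //; case: k k3 => [|[|[|//]]] _ /=; ring.
by rewrite /dot3 /toR /fform !intrD; ring.
Qed.

Lemma form_polyvertex_le (v : nat) : (v < 11)%N ->
  `|dot3 (toR (fform f)) (polyvertex v)| <= facetdet f.
Proof.
move=> v11; case: (boolP (v \in verts f)) => [vf|/(form_vertex v11)/ltW //].
have {vf} [k k3 ->] : exists2 k, (k < 3)%N & v = fvert f k.
  by move: vf; rewrite verts_fvert !inE => /or3P[] /eqP->; [exists 0%N|exists 1%N|exists 2%N].
by rewrite -dot3_facetvertex // form_facetvertex // ger0_norm // ltW // facetdet_gt0.
Qed.

Lemma supported_sum s : supported f s -> \sum_v s v = s (idx f 0) + s (idx f 1) + s (idx f 2).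
Proof.
move=> sf; rewrite (eq_bigr (fun v => s v * 1)) ?(sum_supported _ sf) ?mulr1 // => v _.
by rewrite mulr1.
Qed.

End Facet.

Lemma quad_form s f : f \in facets -> supported f s -> \sum_v s v = 1 ->
  quad (toR (fform f)) s = facetdet f ^+ 2.
Proof.
move=> fF sf s1; rewrite (quad_facet fF) // dot3_point !form_facetvertex // -!mulrDl.
by rewrite -(supported_sum fF sf) s1 mul1r.
Qed.

Lemma trace_gt0 s f : f \in facets -> supported f s -> \sum_v s v = 1 -> 0 < trace s.
Proof.
move=> fF sf s1; have := quad_form fF sf s1; rewrite (quad_facet fF) // (trace_facet fF) //.
have := facetdet_gt0 fF; move: (facetdet f) (point f s) => d u d0 h.
have hu : dot3 (toR (fform f)) u != 0.
  by apply/eqP => e; move: h; rewrite e expr0n /= => /esym/eqP; rewrite sqrf_eq0 gt_eqF.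
have sq k : 0 <= u k * u k by rewrite -expr2 sqr_ge0.
have uu0 : 0 <= dot3 u u by rewrite /dot3 !addr_ge0.
rewrite lt0r uu0 andbT; apply/negP; rewrite /dot3 !paddr_eq0 ?addr_ge0 //.
rewrite !mulf_eq0 !orbb => /andP[/andP[/eqP e0 /eqP e1] /eqP e2]; case/eqP: hu.
by rewrite /dot3 e0 e1 e2 !mulr0 !addr0.
Qed.

(** The point is a convex combination of signed vertices, where the form of [f] is at most
    [facetdet f] in absolute value, and strictly less off [f]. The maximum identifies the facet from
    even data. *)
Lemma quad_form_le s f f' : f \in facets -> f' \in facets -> supported f' s ->
  (forall v, 0 <= s v) -> \sum_v s v = 1 -> quad (toR (fform f)) s <= facetdet f ^+ 2 /\
  (quad (toR (fform f)) s = facetdet f ^+ 2 -> supported f s).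
Proof.
move=> fF fF' sf' s0 s1; rewrite (quad_facet fF') // dot3_point.
rewrite (supported_sum fF' sf') in s1.
have d0 := facetdet_gt0 fF.
have cE k : (k < 3)%N -> `|dot3 (toR (fform f)) (facetvertex f' k)| <= facetdet f /\
    (fvert f' k \notin verts f -> `|dot3 (toR (fform f)) (facetvertex f' k)| < facetdet f).
  move=> k3; rewrite (dot3_facetvertex fF') //; have [_ _ h] := facet_verts fF'.
  by split; [apply: form_polyvertex_le|apply: form_vertex] => //; apply: h; apply: fvert_mem.
have [c0 d0'] := cE 0%N isT; have [c1 d1'] := cE 1%N isT; have [c2 d2'] := cE 2%N isT.
have sf (v : 'I_11) : (forall k, (k < 3)%N -> fvert f' k \notin verts f -> s (idx f' k) = 0) ->
    (v : nat) \notin verts f -> s v = 0.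
  move=> h vf; case: (boolP ((v : nat) \in verts f')) => [|/sf' //].
  rewrite (verts_fvert fF') !inE => /or3P[] /eqP vE; rewrite vE in vf;
  [have := h 0%N isT vf|have := h 1%N isT vf|have := h 2%N isT vf];
  by rewrite (_ : idx f' _ = v) //; apply: val_inj; rewrite /= idx_val.
have z0 := s0 (idx f' 0); have z1 := s0 (idx f' 1); have z2 := s0 (idx f' 2).
move: c0 c1 c2 d0' d1' d2'.
set x := dot3 _ (facetvertex f' 0); set y := dot3 _ (facetvertex f' 1).
set z := dot3 _ (facetvertex f' 2).
move=> c0 c1 c2 d0' d1' d2'.
have le1 : `|s (idx f' 0) * x + s (idx f' 1) * y + s (idx f' 2) * z| <=
    s (idx f' 0) * `|x| + s (idx f' 1) * `|y| + s (idx f' 2) * `|z|.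
  rewrite -[s (idx f' 0) in leRHS]ger0_norm // -[s (idx f' 1) in leRHS]ger0_norm //.
  rewrite -[s (idx f' 2) in leRHS]ger0_norm // -!normrM.
  by apply: le_trans (ler_normD _ _) _; rewrite lerD2r ler_normD.
have m0 : 0 <= s (idx f' 0) * (facetdet f - `|x|) by rewrite mulr_ge0 // subr_ge0.
have m1 : 0 <= s (idx f' 1) * (facetdet f - `|y|) by rewrite mulr_ge0 // subr_ge0.
have m2 : 0 <= s (idx f' 2) * (facetdet f - `|z|) by rewrite mulr_ge0 // subr_ge0.
have tot : s (idx f' 0) * facetdet f + s (idx f' 1) * facetdet f + s (idx f' 2) * facetdet f
    = facetdet f.
  by rewrite -!mulrDl s1 mul1r.
split.
  rewrite -[leLHS]real_normK ?num_real //; rewrite ler_pXn2r ?nnegrE ?(ltW d0) //.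
  by apply: le_trans le1 _; lra.
move=> e; move=> v; apply: sf => k k3 kf.
have {e le1} e : facetdet f <= s (idx f' 0) * `|x| + s (idx f' 1) * `|y| + s (idx f' 2) * `|z|.
  apply: le_trans le1; rewrite -(ler_pXn2r (n := 2)) ?nnegrE ?(ltW d0) //.
  by rewrite real_normK ?num_real // e.
case: k k3 kf => [|[|[|//]]] _ kf.
- have /eqP : s (idx f' 0) * (facetdet f - `|x|) = 0 by lra.
  by rewrite mulf_eq0 subr_eq0 (gt_eqF (d0' kf)) orbF => /eqP.
- have /eqP : s (idx f' 1) * (facetdet f - `|y|) = 0 by lra.
  by rewrite mulf_eq0 subr_eq0 (gt_eqF (d1' kf)) orbF => /eqP.
- have /eqP : s (idx f' 2) * (facetdet f - `|z|) = 0 by lra.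
  by rewrite mulf_eq0 subr_eq0 (gt_eqF (d2' kf)) orbF => /eqP.
Qed.

Lemma pt_supported s : pt (R := R) rp2_11 s -> exists2 f, f \in facets & supported f s.
Proof.
move=> [_ _ /rp2_11P[f fF h]]; exists f => // v; apply: contraNeq => sv.
by apply: h; rewrite inE.
Qed.

(** Normalised moments forget the length. Testing both points with the forms of both facets bounds
    each trace by the other, so they agree; the equality case puts [s'] on the facet of [s], where
    the normals recover the squares of the nonnegative coordinates. *)
Lemma moment_inj s s' : pt (R := R) rp2_11 s -> pt (R := R) rp2_11 s' ->
  (forall i j, (i < 3)%N -> (j < 3)%N -> moment s i j / trace s = moment s' i j / trace s') ->
  s = s'.
Proof.
move=> ps ps'; have [f fF sf] := pt_supported ps; have [f' fF' sf'] := pt_supported ps'.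
have [s0 s1 _] := ps; have [s0' s1' _] := ps'.
have t0 := trace_gt0 fF sf s1; have t0' := trace_gt0 fF' sf' s1'.
move=> e; have {e} q n : quad n s * trace s' = quad n s' * trace s.
  have m i j : (i < 3)%N -> (j < 3)%N -> moment s i j * trace s' = moment s' i j * trace s.
    move=> i3 j3; have /eqP := e i j i3 j3.
    by rewrite eqr_div ?(lt0r_neq0 t0) ?(lt0r_neq0 t0') // => /eqP.
  have E z c : quad n z * c = dot3 n (fun i => dot3 n (fun j => moment z i j * c)).
    by rewrite /quad /dot3; ring.
  by rewrite !E /dot3 !m.
have d0 := facetdet_gt0 fF; have d0' := facetdet_gt0 fF'.
have [b1 sup] := quad_form_le fF fF' sf' s0' s1'.
have [b2 _] := quad_form_le fF' fF sf s0 s1.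
have q1 := q (toR (fform f)); have q2 := q (toR (fform f')).
rewrite (quad_form fF sf s1) in q1; rewrite (quad_form fF' sf' s1') in q2.
have dd : 0 < facetdet f ^+ 2 by rewrite exprn_gt0.
have dd' : 0 < facetdet f' ^+ 2 by rewrite exprn_gt0.
have tt : trace s = trace s' by apply/eqP; rewrite eq_le; apply/andP; split; nra.
have {}q n : quad n s = quad n s'.
  by apply: (mulIf (lt0r_neq0 t0)); rewrite [in LHS]tt q.
have {sup} sf2 : supported f s' by apply: sup; rewrite -q (quad_form fF sf s1).
apply: boolp.funext => v; case: (boolP ((v : nat) \in verts f)) => vf; last by rewrite sf // sf2.
have [k k3 ->] : exists2 k, (k < 3)%N & v = idx f k.
  move: vf; rewrite (verts_fvert fF) !inE.
  by move=> /or3P[] /eqP vE; [exists 0%N|exists 1%N|exists 2%N]; rewrite ?inE //;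
     apply: val_inj; rewrite /= idx_val.
have := q (toR (fnormal f k)); rewrite !(quad_facet fF) // !normal_point // !exprMn.
move=> /(mulIf (lt0r_neq0 dd)) /eqP.
by rewrite eqrXn2 // => /eqP.
Qed.

(* Maximize |form| over the facets: a negative coordinate would increase the form of
   the facet across the opposite edge. *)
Lemma facet_cover p : (exists2 i, (i < 3)%N & p i != 0) ->
  exists2 f, f \in facets & exists eta : R, [/\ eta ^+ 2 = 1,
    0 < eta * (alpha f 0 p + alpha f 1 p + alpha f 2 p) &
    forall k, (k < 3)%N -> 0 <= eta * alpha f k p].
Proof.
move=> p0; pose ell f := alpha f 0 p + alpha f 1 p + alpha f 2 p.
have [f fF fmax] : exists2 f, f \in facets & forall g, g \in facets -> `|ell g| <= `|ell f|.
  pose F (i : 'I_20) := `|ell (nth [::] facets i)|.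
  case: (@arg_maxP _ R 'I_20 ord0 xpredT F isT) => i _ h.
  exists (nth [::] facets i); first exact: mem_nth.
  move=> g gF; have gi : (index g facets < 20)%N by rewrite index_mem.
  by have := h (Ordinal gi) isT; rewrite /F /= nth_index.
have [eta [eta2 etaE]] : exists eta : R, eta ^+ 2 = 1 /\ eta * ell f = `|ell f|.
  have [h|h] := leP 0 (ell f).
    by exists 1; rewrite expr1n mul1r ger0_norm.
  by exists (-1); rewrite sqrrN expr1n mulN1r ltr0_norm.
exists f => //; exists eta.
have pos k : (k < 3)%N -> 0 <= eta * alpha f k p.
  move=> k3; rewrite leNgt; apply/negP => neg.
  have /and5P[_ _ _ _ /andP[/allP h _]] := allP facetsP f fF.
  have /hasP[g gF /andP[kg /hasP[e e1 /allP he]]] := h k (iota3 k3).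
  have dg := facetdet_gt0 gF.
  have eN : `|e%:~R| = 1 :> R by rewrite -intr_norm; move: e1; rewrite !inE => /orP[] /eqP->.
  have c j : (j < 3)%N -> j != k -> e%:~R * dot3 (toR (fform g)) (facetvertex f j) = facetdet g.
    move=> j3 jk; have := he j (iota3 j3); rewrite (negPf jk) /= => /eqP hj.
    by rewrite dot3_toR -intrM hj.
  have ck : e%:~R * dot3 (toR (fform g)) (facetvertex f k) < facetdet g.
    apply: le_lt_trans (ler_norm _) _; rewrite normrM eN mul1r (dot3_facetvertex fF) //.
    by apply: (form_vertex gF) => //; have [_ _ hv] := facet_verts fF; apply: hv; apply: fvert_mem.
  have gE : ell g * facetdet g = alpha f 0 p * dot3 (toR (fform g)) (facetvertex f 0)
      + alpha f 1 p * dot3 (toR (fform g)) (facetvertex f 1)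
      + alpha f 2 p * dot3 (toR (fform g)) (facetvertex f 2).
    by rewrite -(form_sum gF) (dot3_expand fF).
  have big : e%:~R * (eta * (ell g * facetdet g)) <= eta * ell f * facetdet g.
    rewrite etaE; apply: le_trans (ler_norm _) _.
    rewrite !normrM eN mul1r (ger0_norm (ltW dg)).
    have -> : `|eta| = 1.
      by apply/eqP; rewrite -sqr_norm_eq1 eta2.
    by rewrite mul1r ler_wpM2r ?(ltW dg) // fmax.
  have := big; rewrite gE leNgt => /negP; apply.
  rewrite /ell -subr_gt0.
  have E : e%:~R * (eta * (alpha f 0 p * dot3 (toR (fform g)) (facetvertex f 0)
      + alpha f 1 p * dot3 (toR (fform g)) (facetvertex f 1)
      + alpha f 2 p * dot3 (toR (fform g)) (facetvertex f 2)))
    = eta * alpha f 0 p * (e%:~R * dot3 (toR (fform g)) (facetvertex f 0))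
      + eta * alpha f 1 p * (e%:~R * dot3 (toR (fform g)) (facetvertex f 1))
      + eta * alpha f 2 p * (e%:~R * dot3 (toR (fform g)) (facetvertex f 2)) by ring.
  rewrite E {E}.
  have m : 0 < (eta * alpha f k p) * (e%:~R * dot3 (toR (fform g)) (facetvertex f k) - facetdet g).
    by rewrite nmulr_rgt0 // subr_lt0.
  case: k k3 neg h kg he c ck m => [|[|[|//]]] _ _ _ _ _ c _ m.
  - by rewrite (c 1%N) // (c 2%N) //; move: m; congr (_ < _); ring.
  - by rewrite (c 0%N) // (c 2%N) //; move: m; congr (_ < _); ring.
  - by rewrite (c 0%N) // (c 1%N) //; move: m; congr (_ < _); ring.
(* If the maximum were 0, the three nonnegative coordinates would vanish, and [p] with them. *)
split=> //; rewrite -/(ell f) etaE normr_gt0; apply/eqP => l0.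
have [i i3 pi] := p0.
have a0 := pos 0%N isT; have a1 := pos 1%N isT; have a2 := pos 2%N isT.
have sum0 : eta * alpha f 0 p + eta * alpha f 1 p + eta * alpha f 2 p = 0.
  by rewrite -!mulrDr -/(ell f) l0 mulr0.
have eta0 : eta != 0.
  by apply/eqP => e0; move: eta2; rewrite e0 expr0n /= => /eqP; rewrite eq_sym oner_eq0.
have z k : eta * alpha f k p = 0 -> alpha f k p = 0.
  by move=> /eqP; rewrite mulf_eq0 (negPf eta0) => /eqP.
have aux (a b c : R) : 0 <= a -> 0 <= b -> 0 <= c -> a + b + c = 0 -> [/\ a = 0, b = 0 & c = 0].
  by move=> *; split; lra.
have [/z e0 /z e1 /z e2] := aux _ _ _ a0 a1 a2 sum0.
by case/eqP: pi; rewrite (expand fF p i3) e0 e1 e2 !mul0r !addr0.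
Qed.

End Polytope.

(** The equality case of Cauchy-Schwarz: for unit vectors, [dot p q] equal to 1 or -1 makes [p - q]
    or [p + q] of length zero. *)
Lemma veronese_inj (R : realType) (y y' : RP2 R) :
  (forall ij, veronese ij y = veronese ij y') -> y = y'.
Proof.
move=> h; have S2 z : dot (\val (section z)) (\val (section z)) = 1 :> R.
  by apply/sphere_dot; exact: set_mem (valP (section z)).
have d2 : dot (\val (section y)) (\val (section y')) ^+ 2 = 1.
  rewrite -veronese_dot (eq_bigr (fun ij => veronese ij y * veronese ij y)).
    by rewrite veronese_dot S2 expr1n.
  by move=> ij _; rewrite h.
rewrite -(sectionK y) -(sectionK y'); apply/proj_eq.
have := S2 y; have := S2 y'; move: d2.
move: (\val (section y)) (\val (section y')) => p q.
have eq0 (z : 'rV[R]_3) : dot z z = 0 -> z = 0.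
  rewrite dotE -!expr2 => /eqP; rewrite !paddr_eq0 ?addr_ge0 ?sqr_ge0 // !sqrf_eq0.
  move=> /andP[/andP[/eqP z0 /eqP z1] /eqP z2]; apply/rowP => i; rewrite mxE.
  have [->|->|->] // : [\/ i = 0, i = 1 | i = 2%:R].
  by case: i => [[|[|[|//]]] hi]; [apply: Or31|apply: Or32|apply: Or33]; apply: val_inj.
move=> /eqP; rewrite sqrf_eq1 => /orP[] /eqP pq qq pp; [left|right].
  apply/eqP; rewrite -subr_eq0; apply/eqP/eq0; move: pq qq pp; rewrite !dotE /coord !mxE; lra.
apply/eqP; rewrite -subr_eq0 opprK; apply/eqP/eq0; move: pq qq pp; rewrite !dotE /coord !mxE; lra.
Qed.

Section Eleven.
Variable R : realType.

Lemma dot3_coord (p : 'rV[R]_3) :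
  dot3 (fun i => p ord0 (inord i)) (fun i => p ord0 (inord i)) = dot p p.
Proof.
rewrite dotE /dot3 /coord.
by congr (p _ _ * p _ _ + p _ _ * p _ _ + p _ _ * p _ _); apply: val_inj; rewrite /= inordK.
Qed.

Theorem rp2_11_RP2 : RP2_triangulation R rp2_11.
Proof.
split; first exact: rp2_11_complex.
pose a (ij : 'I_3 * 'I_3) (s : realization R rp2_11) : R :=
  moment (\val s) ij.1 ij.2 / trace (\val s).
have rpt (s : realization R rp2_11) : pt (R := R) rp2_11 (\val s) by exact: set_mem (valP s).
have tr0 (s : realization R rp2_11) : 0 < trace (\val s : 'I_11 -> R).
  have [f fF sf] := pt_supported (rpt s); have [_ s1 _] := rpt s.
  exact: trace_gt0 fF sf s1.
apply: (@homeomorphic_images R ('I_3 * 'I_3)%type _ _ a (fun ij => @veronese R ij)).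
- exact/compact_set_type/realization_compact/rp2_11_complex.
- have -> : [set: RP2 R] = @proj R @` setT.
    by apply/seteqP; split=> // y _; apply: (ex_intro2 _ _ (section y) I (sectionK y)).
  apply: (@continuous_compact _ _ (@proj R)); last exact/compact_set_type/sphere_compact.
  by apply: continuous_subspaceT; exact: pi_continuous.
- have cm i j : continuous (fun s : realization R rp2_11 => moment (\val s : 'I_11 -> R) i j).
    apply: continuous_sum => v; apply: continuous_sum => w s.
    have c x := @coordinate_continuous R _ rp2_11 x s.
    exact: (cvgM (cvgM (cvgM (cvgM (c v) (c w)) (cvg_cst _)) (cvg_cst _)) (cvg_cst _)).
  have ct : continuous (fun s : realization R rp2_11 => trace (\val s : 'I_11 -> R)).
    by move=> s; exact: (cvgD (cvgD (cm 0%N 0%N s) (cm 1%N 1%N s)) (cm 2%N 2%N s)).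
  by move=> ij s; exact: (cvgM (cm ij.1 ij.2 s) (cvgV (lt0r_neq0 (tr0 s)) (ct s))).
- exact: veronese_continuous.
- move=> s s' h; apply: val_inj; apply: moment_inj; try exact: rpt.
  by move=> i j i3 j3; have := h (Ordinal i3, Ordinal j3).
- exact: veronese_inj.
- move=> s; have [f fF sf] := pt_supported (rpt s).
  pose u := point f (\val s : 'I_11 -> R); pose T := trace (\val s : 'I_11 -> R).
  have T0 : 0 < T := tr0 s.
  pose p : 'rV[R]_3 := \row_i (u i / Num.sqrt T).
  have sT : Num.sqrt T ^+ 2 = T by rewrite sqr_sqrtr // ltW.
  have sT0 : Num.sqrt T != 0 by rewrite sqrtr_eq0 -ltNge.
  have pE (i j : 'I_3) : p ord0 i * p ord0 j = u i * u j / T.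
    by rewrite !mxE -[in RHS]sT; field.
  have sp : sphere2 R p.
    apply/sphere_dot; rewrite dotE /coord !pE -!mulrDl -/(dot3 u u).
    by rewrite -(trace_facet fF sf) divff // gt_eqF.
  exists (proj (exist _ p (mem_set sp))) => ij.
  by rewrite veronese_proj /coord /= pE /a (moment_facet fF).
- move=> y; pose x := \val (section y); pose p i := x ord0 (inord i).
  have sx : dot3 p p = 1.
    by rewrite /p dot3_coord; apply/sphere_dot; exact: set_mem (valP (section y)).
  have [|f fF [eta [eta2 S0 pos]]] := @facet_cover R p.
    apply: contrapT => h; have z i : (i < 3)%N -> p i = 0.
      by move=> i3; apply/eqP; apply: contrapT => /negP pi; apply: h; exists i.
    by move: sx; rewrite /dot3 !z // !mulr0 !addr0 => /eqP; rewrite eq_sym oner_eq0.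
  set S := eta * _ in S0.
  (* [eta] selects the antipode lying in the cone over [f], and dividing by [S] rescales it to the
     plane of [f], where coordinates sum to 1. *)
  pose s (v : 'I_11) : R := eta * (
    (if v == idx f 0 then alpha f 0 p else 0) + (if v == idx f 1 then alpha f 1 p else 0)
    + (if v == idx f 2 then alpha f 2 p else 0)) / S.
  have [_ uf _] := facet_verts fF; rewrite (verts_fvert fF) /= !inE negb_or in uf.
  move: uf => /and3P[/andP[u01 u02] u12 _].
  have n01 : idx f 0 != idx f 1 by rewrite -val_eqE /= !idx_val.
  have n02 : idx f 0 != idx f 2 by rewrite -val_eqE /= !idx_val.
  have n12 : idx f 1 != idx f 2 by rewrite -val_eqE /= !idx_val.
  have s0 : s (idx f 0) = eta * alpha f 0 p / S.
    by rewrite /s eqxx (negPf n01) (negPf n02) !addr0.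
  have s1 : s (idx f 1) = eta * alpha f 1 p / S.
    by rewrite /s eqxx eq_sym (negPf n01) (negPf n12) addr0 add0r.
  have s2 : s (idx f 2) = eta * alpha f 2 p / S.
    by rewrite /s eqxx eq_sym (negPf n02) eq_sym (negPf n12) !add0r.
  have sf : supported f s.
    move=> v; rewrite (verts_fvert fF) !inE !negb_or => /and3P[v0 v1 v2].
    have ne k : (k < 3)%N -> (v : nat) != fvert f k -> (v == idx f k) = false.
      by move=> k3 vk; rewrite -val_eqE /= idx_val // (negPf vk).
    by rewrite /s !ne // !addr0 mulr0 mul0r.
  have Sn0 : S != 0 by rewrite gt_eqF.
  have ps : pt (R := R) rp2_11 s.
    split.
    - move=> v; case: (boolP ((v : nat) \in verts f)) => [|/sf->//].
      have P k : (k < 3)%N -> 0 <= eta * alpha f k p / S.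
        by move=> k3; rewrite divr_ge0 ?pos // ltW.
      rewrite (verts_fvert fF) !inE => /or3P[] /eqP vE.
      + by rewrite (_ : v = idx f 0) ?s0 ?P //; apply: val_inj; rewrite /= idx_val.
      + by rewrite (_ : v = idx f 1) ?s1 ?P //; apply: val_inj; rewrite /= idx_val.
      + by rewrite (_ : v = idx f 2) ?s2 ?P //; apply: val_inj; rewrite /= idx_val.
    - by rewrite (supported_sum fF sf) s0 s1 s2 -!mulrDl -!mulrDr -/S divff.
    - apply/rp2_11P; exists f => // v; rewrite inE; apply: contraR => vf.
      by rewrite sf.
  have pE i : (i < 3)%N -> point f s i = eta / S * p i.
    by move=> i3; rewrite /point s0 s1 s2 (expand fF p i3); field.
  have mE i j : (i < 3)%N -> (j < 3)%N -> moment s i j = (eta / S) ^+ 2 * (p i * p j).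
    by move=> i3 j3; rewrite (moment_facet fF) // !pE //; ring.
  have tE : trace s = (eta / S) ^+ 2 by rewrite /trace !mE // -!mulrDr -/(dot3 p p) sx mulr1.
  exists (exist _ s (mem_set ps)) => ij.
  rewrite /a /= tE mE // mulrAC divff ?mul1r; first by rewrite /veronese /p !inord_val.
  by rewrite expr_div_n eta2 div1r invr_eq0 sqrf_eq0.
Qed.

End Eleven.

Theorem theorem4p5 (R : realType) :
  (exists (T : finType) (K : {set {set T}}),
      [/\ RP2_triangulation R K, flag K & #|T| = 11%N])
  /\ (forall (T : finType) (K : {set {set T}}),
        RP2_triangulation R K -> flag K -> (11 <= #|T|)%N).
Proof.
split; last exact: RP2_flag_lower.
by exists 'I_11, rp2_11; split; [exact: rp2_11_RP2|exact: rp2_11_flag|rewrite card_ord].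
Qed.
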